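(* Let $X_\Sigma$ be a smooth compact toric variety, given by a fan $\Sigma$ in $\mathbb{R}^n$, and let $R=\mathbb{C}[y_1,\dots,y_d]$. Then: (1) If $F=(f_1,\dots,f_r)\in R^r$ is $\Sigma$-irreducible, then $\pi\circ F$ gives a well-defined rational map $\pi\circ F:\mathbb{C}^d\dashrightarrow X_\Sigma$. (2) If $F$ and $F'$ are $\Sigma$-irreducible, then $\pi\circ F=\pi\circ F'$ as rational maps if and only if $F'=\mu\cdot F$ for some $\mu\in G$. (3) Every rational map $f:\mathbb{C}^d\dashrightarrow X_\Sigma$ is of the form $\pi\circ F$ for some $\Sigma$-irreducible $F\in R^r$. Hence rational maps $f:\mathbb{C}^d\dashrightarrow X_\Sigma$ correspond bijectively to $G$-equivalence classes of $\Sigma$-irreducible $(f_1,\dots,f_r)\in R^r$.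
   Context: Everything is over $\mathbb{C}$; $\mathbb{C}^*=\mathbb{C}\setminus\{0\}$; $\langle\,,\rangle$ is the dot product on $\mathbb{Z}^n$. $X_\Sigma$ is the toric variety of a fan $\Sigma$ in $\mathbb{R}^n$; compactness means the union of the cones of $\Sigma$ is $\mathbb{R}^n$, and $X_\Sigma$ may be non-projective. Smooth means that the generators of every $n$-dimensional cone of $\Sigma$ form a $\mathbb{Z}$-basis of $\mathbb{Z}^n$. Let $\rho_1,\dots,\rho_r$ be the edges (one-dimensional cones) of $\Sigma$, $n_i\in\mathbb{Z}^n$ the first nonzero integer vector on $\rho_i$, and $x_1,\dots,x_r$ coordinates on $\mathbb{C}^r$, with $x_i$ corresponding to $\rho_i$. Put $G=\{(\mu_1,\dots,\mu_r)\in(\mathbb{C}^* )^r\mid\prod_{i=1}^r\mu_i^{\langle m,n_i\rangle}=1\text{ for all }m\in\mathbb{Z}^n\}$, acting coordinatewise on $\mathbb{C}^r$ and on $R^r$ by $\mu\cdot F=(\mu_1f_1,\dots,\mu_rf_r)$. For $\sigma\in\Sigma$ let $x^{\hat\sigma}=\prod_{n_i\notin\sigma}x_i$, and let $Z\subset\mathbb{C}^r$ be the common zero locus of all $x^{\hat\sigma}$, $\sigma\in\Sigma$. Then $X_\Sigma=(\mathbb{C}^r\setminus Z)/G$ (standard homogeneous coordinate/Cox construction), and $\pi:\mathbb{C}^r\dashrightarrow X_\Sigma$ is the rational map given by the quotient map $\mathbb{C}^r\setminus Z\to X_\Sigma$. $F=(f_1,\dots,f_r)\in R^r$ is identified with the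 polynomial map $\mathbb{C}^d\to\mathbb{C}^r$ it defines. $F$ is $\Sigma$-irreducible if $\gcd(f_{i_1},\dots,f_{i_k})=1$ whenever no cone of $\Sigma$ contains $\rho_{i_1},\dots,\rho_{i_k}$, with the convention $\gcd(0,\dots,0)=0$. Two elements $F,F'\in R^r$ are $G$-equivalent if $F'=\mu\cdot F$ for some $\mu\in G$. Rational maps are not required to be dominant. *)

(* Defs.v *)
From HB Require Import structures.
From mathcomp Require Import all_boot all_order all_algebra.
From mathcomp Require Import boolp classical_sets functions cardinality reals.
From mathcomp Require Import complex mpoly.

Set Implicit Arguments.
Unset Strict Implicit.
Unset Printing Implicit Defensive.

Import Order.TTheory GRing.Theory Num.Theory.
Local Open Scope classical_set_scope.
Local Open Scope ring_scope.

(** * Fans *)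

Definition dot (K : pzRingType) (n : nat) (u v : 'rV[K]_n) : K :=
  \sum_j u 0 j * v 0 j.

(* The inclusion of Z^n in R^n. *)
Definition latt (R : realType) (n : nat) (m : 'rV[int]_n) : 'rV[R]_n :=
  map_mx (fun z : int => z%:~R) m.
Arguments latt R {n} m.

Definition rational_polyhedral_cone (R : realType) (n : nat)
    (sigma : set 'rV[R]_n) : Prop :=
  exists (k : nat) (g : 'I_k -> 'rV[int]_n),
    sigma = [set v | exists c : 'I_k -> R,
      (forall i, 0 <= c i) /\ v = \sum_i c i *: latt R (g i)].

Definition strongly_convex (R : realType) (n : nat)
    (sigma : set 'rV[R]_n) : Prop :=
  forall v, sigma v -> sigma (- v) -> v = 0.

(* Faces are cut out by supporting hyperplanes; u = 0 gives sigma itself. *)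
Definition face_of (R : realType) (n : nat) (tau sigma : set 'rV[R]_n) : Prop :=
  exists u : 'rV[R]_n,
    (forall v, sigma v -> 0 <= dot u v) /\
    tau = [set v | sigma v /\ dot u v = 0].

Definition is_fan (R : realType) (n : nat)
    (Sigma : set (set 'rV[R]_n)) : Prop :=
  [/\ finite_set Sigma,
      forall sigma, Sigma sigma ->
        rational_polyhedral_cone sigma /\ strongly_convex sigma,
      forall sigma tau, Sigma sigma -> face_of tau sigma -> Sigma tau &
      forall sigma tau, Sigma sigma -> Sigma tau ->
        face_of (sigma `&` tau) sigma /\ face_of (sigma `&` tau) tau].

(* X_Sigma is compact iff the cones of Sigma cover R^n. *)
Definition complete_fan (R : realType) (n : nat)
    (Sigma : set (set 'rV[R]_n)) : Prop :=
  \bigcup_(sigma in Sigma) sigma = [set: 'rV[R]_n].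

(* The dimension of a cone is that of its linear span; here the rows of A form
   a basis of the span consisting of vectors of the cone. *)
Definition cone_dim (R : realType) (n : nat)
    (sigma : set 'rV[R]_n) (k : nat) : Prop :=
  exists A : 'M[R]_(k, n),
    [/\ row_free A, forall i, sigma (row i A) &
        forall v, sigma v -> (v <= A)%MS].

(* rho enumerates the edges of Sigma, without repetition. *)
Definition edges_of (R : realType) (n r : nat)
    (Sigma : set (set 'rV[R]_n)) (rho : 'I_r -> set 'rV[R]_n) : Prop :=
  set_bij [set: 'I_r] [set tau | Sigma tau /\ cone_dim tau 1] rho.

(* v is the nonzero integer vector met first when following the ray tau from
   the origin. *)
Definition first_lattice_vector (R : realType) (n : nat)
    (tau : set 'rV[R]_n) (v : 'rV[int]_n) : Prop :=
  [/\ v != 0, tau (latt R v) &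
      forall w : 'rV[int]_n, w != 0 -> tau (latt R w) ->
        exists2 t : R, 1 <= t & latt R w = t *: latt R v].

(* {nu i | nu i in sigma} is a Z-basis of Z^n: every integer vector has a unique
   coordinate vector c supported on the indices i with nu i in sigma. *)
Definition generators_form_Zbasis (R : realType) (n r : nat)
    (nu : 'I_r -> 'rV[int]_n) (sigma : set 'rV[R]_n) : Prop :=
  forall m : 'rV[int]_n, exists! c : 'rV[int]_r,
    (forall i, ~ sigma (latt R (nu i)) -> c 0 i = 0) /\
    m = \sum_i c 0 i *: nu i.

Definition smooth_fan (R : realType) (n r : nat)
    (Sigma : set (set 'rV[R]_n)) (nu : 'I_r -> 'rV[int]_n) : Prop :=
  forall sigma, Sigma sigma -> cone_dim sigma n ->
    generators_form_Zbasis nu sigma.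

(** * Spaces with functions, morphisms and rational maps *)

(* Varieties over C are described by their closed points: a set of points (in an
   ambient type), its Zariski open subsets, and for each open subset the
   C-valued functions regular on it.  Functions are total on the ambient type;
   only their values on the open set at hand are meaningful. *)
Record funspace (R : realType) (T : Type) := FunSpace {
  pts : set T;
  open_in : set (set T);
  regular_on : set T -> set (T -> R[i])
}.

Definition morphism_on (R : realType) (S T : Type)
    (X : funspace R S) (Y : funspace R T) (U : set S) (f : S -> T) : Prop :=
  [/\ forall x, U x -> pts Y (f x),
      forall V, open_in Y V -> open_in X (U `&` f @^-1` V) &
      forall V h, open_in Y V -> regular_on Y V h ->
        regular_on X (U `&` f @^-1` V) (h \o f)].

(* A partial map: a domain of definition and a function on it. *)
Definition pmap (S T : Type) : Type := (set S * (S -> T))%type.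

Definition rat_rep (R : realType) (S T : Type)
    (X : funspace R S) (Y : funspace R T) (phi : pmap S T) : Prop :=
  [/\ open_in X phi.1, phi.1 !=set0 & morphism_on X Y phi.1 phi.2].

Definition rat_equiv (R : realType) (S T : Type)
    (X : funspace R S) (phi psi : pmap S T) : Prop :=
  exists W : set S,
    [/\ open_in X W, W !=set0, W `<=` phi.1 `&` psi.1 &
        forall x, W x -> phi.2 x = psi.2 x].

(* A rational map from X (assumed irreducible, so that nonempty open sets are
   dense) to Y is an equivalence class of morphisms defined on nonempty open
   subsets of X. *)
Definition rat_class (R : realType) (S T : Type)
    (X : funspace R S) (Y : funspace R T) (phi : pmap S T) : set (pmap S T) :=
  [set psi | rat_rep X Y psi /\ rat_equiv X phi psi].

Definition rational_maps (R : realType) (S T : Type)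
    (X : funspace R S) (Y : funspace R T) : set (set (pmap S T)) :=
  [set f | exists2 phi, rat_rep X Y phi & f = rat_class X Y phi].

(** * Affine space *)

Definition cpt (R : realType) (d : nat) : Type := 'I_d -> R[i].

Definition zariski_open (R : realType) (d : nat) (U : set (cpt R d)) : Prop :=
  exists S : set {mpoly R[i][d]},
    U = [set x | exists2 p, S p & p.@[x] != 0].

Definition zariski_regular (R : realType) (d : nat) (U : set (cpt R d))
    (h : cpt R d -> R[i]) : Prop :=
  forall x, U x -> exists (V : set (cpt R d)) (p q : {mpoly R[i][d]}),
    [/\ zariski_open V, V x, V `<=` U &
        forall y, V y -> q.@[y] != 0 /\ h y = p.@[y] / q.@[y]].

Definition affine_space (R : realType) (d : nat) : funspace R (cpt R d) :=
  FunSpace setT (@zariski_open R d) (@zariski_regular R d).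

(** * The toric variety as a quotient *)

Definition cox_group (R : realType) (n r : nat) (nu : 'I_r -> 'rV[int]_n) :
    set ('I_r -> R[i]) :=
  [set mu | (forall i, mu i != 0) /\
            forall m : 'rV[int]_n, \prod_i mu i ^ dot m (nu i) = 1].
Arguments cox_group R {n r} nu.

(* The value at x of the monomial x^{\hat sigma}. *)
Definition xhat (R : realType) (n r : nat) (nu : 'I_r -> 'rV[int]_n)
    (sigma : set 'rV[R]_n) (x : cpt R r) : R[i] :=
  \prod_(i | latt R (nu i) \notin sigma) x i.

Definition cox_Z (R : realType) (n r : nat) (Sigma : set (set 'rV[R]_n))
    (nu : 'I_r -> 'rV[int]_n) : set (cpt R r) :=
  [set x | forall sigma, Sigma sigma -> xhat nu sigma x = 0].

Definition cox_orbit (R : realType) (n r : nat) (nu : 'I_r -> 'rV[int]_n)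
    (x : cpt R r) : set (cpt R r) :=
  [set x' | exists2 mu, cox_group R nu mu & x' = (fun i => mu i * x i)].

(* X_Sigma = (C^r \ Z) / G: its points are the G-orbits in C^r \ Z, a set of
   orbits is open iff its preimage is, and a function on it is regular iff its
   pullback is (the structure of a geometric quotient). *)
Definition toric_variety (R : realType) (n r : nat)
    (Sigma : set (set 'rV[R]_n)) (nu : 'I_r -> 'rV[int]_n) :
    funspace R (set (cpt R r)) :=
  let q : cpt R r -> set (cpt R r) := cox_orbit nu in
  let preim V := ~` cox_Z Sigma nu `&` q @^-1` V in
  let points := q @` (~` cox_Z Sigma nu) in
  FunSpace points
    [set V | V `<=` points /\ zariski_open (preim V)]
    (fun V h => zariski_regular (preim V) (h \o q)).

Definition cox_pi (R : realType) (n r : nat) (Sigma : set (set 'rV[R]_n))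
    (nu : 'I_r -> 'rV[int]_n) : pmap (cpt R r) (set (cpt R r)) :=
  (~` cox_Z Sigma nu, cox_orbit nu).

(** * Sigma-irreducible tuples of polynomials *)

Definition mpoly_dvd (R : realType) (d : nat) (g f : {mpoly R[i][d]}) : Prop :=
  exists h, f = h * g.

(* g is a greatest common divisor of the f i, i in S; a gcd of zeros is 0. *)
Definition is_gcd (R : realType) (d r : nat) (f : 'I_r -> {mpoly R[i][d]})
    (S : {set 'I_r}) (g : {mpoly R[i][d]}) : Prop :=
  (forall i, i \in S -> mpoly_dvd g (f i)) /\
  (forall h, (forall i, i \in S -> mpoly_dvd h (f i)) -> mpoly_dvd h g).

Definition sigma_irreducible (R : realType) (n d r : nat)
    (Sigma : set (set 'rV[R]_n)) (rho : 'I_r -> set 'rV[R]_n)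
    (F : 'I_r -> {mpoly R[i][d]}) : Prop :=
  forall S : {set 'I_r},
    ~ (exists2 sigma, Sigma sigma & forall i, i \in S -> rho i `<=` sigma) ->
    is_gcd F S 1.

Definition g_equivalent (R : realType) (n d r : nat) (nu : 'I_r -> 'rV[int]_n)
    (F F' : 'I_r -> {mpoly R[i][d]}) : Prop :=
  exists2 mu, cox_group R nu mu & F' = (fun i => mu i *: F i).

Definition g_class (R : realType) (n d r : nat) (nu : 'I_r -> 'rV[int]_n)
    (F : 'I_r -> {mpoly R[i][d]}) : set ('I_r -> {mpoly R[i][d]}) :=
  [set F' | g_equivalent nu F F'].

Definition poly_map (R : realType) (d r : nat) (F : 'I_r -> {mpoly R[i][d]})
    (y : cpt R d) : cpt R r :=
  fun i => (F i).@[y].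

(* pi \o F, defined where F does not take values in Z. *)
Definition pi_comp (R : realType) (n d r : nat) (Sigma : set (set 'rV[R]_n))
    (nu : 'I_r -> 'rV[int]_n) (F : 'I_r -> {mpoly R[i][d]}) :
    pmap (cpt R d) (set (cpt R r)) :=
  (poly_map F @^-1` (cox_pi Sigma nu).1, (cox_pi Sigma nu).2 \o poly_map F).

(* Main.v *)
Require Import Defs.
From HB Require Import structures.
From mathcomp Require Import all_boot all_order all_algebra.
From mathcomp Require Import boolp classical_sets functions cardinality reals.
From mathcomp Require Import complex mpoly zify ring.

Set Implicit Arguments.
Unset Strict Implicit.
Unset Printing Implicit Defensive.

Import Order.TTheory GRing.Theory Num.Theory.
Local Open Scope classical_set_scope.
Local Open Scope ring_scope.

(* A point x of C^r lies outside Z exactly when the cone generators n_i with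
   x_i = 0 lie in a common cone, so everything is governed by two facts about a
   smooth complete fan: every lattice vector is a sum of c_i n_i with c_i >= 0
   and the n_i with c_i <> 0 in one cone, and this expression is unique.  Both
   hold modulo the span of a set S of generators of a cone (here S is the set of
   coordinates that vanish identically).

   For a prime polynomial w, let a_i be the order of f_i at w.
   Sigma-irreducibility says that for each w the n_i with a_i > 0, together with
   the n_i, i in S, lie in one cone.  If pi o F = pi o F', then
   F'(y) = mu(y) F(y) with mu(y) in G; comparing the orders of the monomials
   prod (f'_i / f_i)^<m,n_i> = 1 for m orthogonal to S, uniqueness shows that
   F and F' have the same orders, so each f'_i is a constant multiple of f_i.
   Conversely a rational map is given in an affine chart by fractions g_i; the
   existence statement, applied for each w to the vector of orders of the g_i,
   produces a Sigma-irreducible F, and F = mu g where the orders of mu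
   are relations between the n_i, so that mu(y) lies in G. *)

(** * Unique factorization of polynomials *)

Definition divides (A : idomainType) (a b : A) : Prop := exists c, b = c * a.

Definition irreducible_elt (A : idomainType) (a : A) : Prop :=
  [/\ a != 0, a \isn't a GRing.unit &
      forall b c, a = b * c -> b \is a GRing.unit \/ c \is a GRing.unit].

Definition prime_elt (A : idomainType) (a : A) : Prop :=
  a != 0 /\ forall b c, divides a (b * c) -> divides a b \/ divides a c.

(** Existence half of unique factorization; uniqueness is supplied separately, in the form that
    irreducible elements are prime. *)
Definition atomic (A : idomainType) : Prop :=
  forall a : A, a != 0 -> exists (u : A) (s : seq A),
    [/\ u \is a GRing.unit, forall p, p \in s -> irreducible_elt p &
        a = u * \prod_(p <- s) p].

(** [a] divides the product of the leading coefficients, hence one of them; removing that leading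
    term, a multiple of [a], decreases the sum of the sizes. *)
Lemma prime_polyC (A : idomainType) (a : A) :
  prime_elt a -> prime_elt a%:P.
Proof.
move=> [a0 pa]; split; first by rewrite polyC_eq0.
move=> b c; move: {2}(size b + size c)%N (leqnn (size b + size c)) => k.
elim: k b c => [|k IH] b c.
  by rewrite leqn0 addn_eq0 size_poly_eq0 => /andP[/eqP-> _] _;
    left; exists 0; rewrite mul0r.
move=> hk; have [->|b0] := eqVneq b 0; first by left; exists 0; rewrite mul0r.
have [->|c0] := eqVneq c 0; first by right; exists 0; rewrite mul0r.
move=> [e he].
have: divides a (lead_coef b * lead_coef c).
  by exists (lead_coef e); rewrite -lead_coefM he lead_coefM lead_coefC.
have drop (p : {poly A}) : p != 0 ->
    (size (p - (lead_coef p)%:P * 'X^((size p).-1))%R < size p)%N.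
  move=> p0; rewrite [X in (_ < X)%N]polySpred // ltnS.
  apply/leq_sizeP => j hj; rewrite coefB coefCM coefXn.
  move: hj; rewrite leq_eqVlt => /orP[/eqP <-|hj].
    by rewrite eqxx mulr1 lead_coefE subrr.
  rewrite gtn_eqF // mulr0 subr0; apply: nth_default.
  by rewrite polySpred.
case/pa => -[q hq].
- have := drop _ b0; rewrite hq; set b1 := (b - _) => hs.
  have [t bE] : exists t, b = b1 + t * a%:P.
    by exists (q%:P * 'X^((size b).-1)); rewrite /b1 mulrAC -polyCM subrK.
  move: (b1) hs bE => {}b1 hs bE.
  case: (IH b1 c).
  + by rewrite -ltnS; apply: leq_trans hk; rewrite ltn_add2r.
  + by exists (e - t * c); rewrite mulrBl -he mulrAC -mulrBl; congr (_ * _); rewrite bE addrK.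
  + by case=> w hw; left; exists (w + t); rewrite mulrDl -hw.
  + by right.
- have := drop _ c0; rewrite hq; set c1 := (c - _) => hs.
  have [t cE] : exists t, c = c1 + t * a%:P.
    by exists (q%:P * 'X^((size c).-1)); rewrite /c1 mulrAC -polyCM subrK.
  move: (c1) hs cE => {}c1 hs cE.
  case: (IH b c1).
  + by rewrite -ltnS; apply: leq_trans hk; rewrite ltn_add2l.
  + by exists (e - b * t); rewrite mulrBl -he -mulrA -mulrBr; congr (_ * _); rewrite cE addrK.
  + by left.
  + by case=> w hw; right; exists (w + t); rewrite mulrDl -hw.
Qed.

(* Gauss' lemma: denominators of a factorisation over the fraction field can be
   absorbed by the factors. *)
Lemma gauss_clear (A : idomainType) : atomic A ->
  (forall a : A, irreducible_elt a -> prime_elt a) ->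
  forall (c : A) (f g h : {poly A}), c != 0 -> c *: f = g * h ->
  exists (c1 c2 : A) (g' h' : {poly A}),
    [/\ c1 != 0, c2 != 0, g = c1 *: g', h = c2 *: h' & f = g' * h'].
Proof.
move=> atA irrA c f g h /atA[u [s [uu irs ->]]]; elim: s irs g h => [|p s IH] irs g h.
  rewrite big_nil mulr1 => e; exists u, 1, (u^-1 *: g), h.
  split; rewrite ?oner_eq0 ?scale1r //.
  - by apply: contraTneq uu => ->; rewrite unitr0.
  - by rewrite scalerA divrr // scale1r.
  - by rewrite -scalerAl -e scalerA mulVr // scale1r.
have [p0 pp] : prime_elt p by apply/irrA/irs/mem_head.
have irs' q : q \in s -> irreducible_elt q.
  by move=> qs; apply: irs; rewrite in_cons qs orbT.
rewrite big_cons mulrCA -scalerA => e.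
have: divides p%:P (g * h).
  by rewrite -e; eexists; rewrite -mul_polyC mulrC.
have pI : injective (fun x : {poly A} => p *: x).
  by move=> x y; rewrite -!mul_polyC; apply: mulfI; rewrite polyC_eq0.
case/(prime_polyC (conj p0 pp)).2 => -[q qE].
- have gE : g = p *: q by rewrite qE mulrC mul_polyC.
  case: (IH irs' q h); first by apply: pI; rewrite e gE scalerAl.
  move=> c1 [c2 [g' [h' [c10 c20 e1 e2 e3]]]].
  by exists (p * c1), c2, g', h'; split; rewrite ?mulf_neq0 // gE e1 scalerA.
- have hE : h = p *: q by rewrite qE mulrC mul_polyC.
  case: (IH irs' g q); first by apply: pI; rewrite e hE scalerAr.
  move=> c1 [c2 [g' [h' [c10 c20 e1 e2 e3]]]].
  by exists c1, (p * c2), g', h'; split; rewrite ?mulf_neq0 // hE e2 scalerA.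
Qed.

Lemma size_poly_unit (A : idomainType) (p : {poly A}) :
  p \is a GRing.unit -> size p = 1%N.
Proof. by rewrite poly_unitE => /andP[/eqP]. Qed.

Lemma polyC_unit (A : idomainType) (a : A) :
  (a%:P \is a GRing.unit) = (a \is a GRing.unit).
Proof.
have [->|a0] := eqVneq a 0; first by rewrite polyC0 !unitr0.
by rewrite poly_unitE size_polyC a0 coefC.
Qed.

(** Constants are covered by [prime_polyC]. In positive degree, Gauss' lemma and irreducibility show
    that the pseudo-division gcd of [f] and [g] is, up to scaling, [f] or a constant; in the second
    case [f] divides [h]. *)
Lemma poly_irreducible_prime (A : idomainType) : atomic A ->
  (forall a : A, irreducible_elt a -> prime_elt a) ->
  forall f : {poly A}, irreducible_elt f -> prime_elt f.
Proof.
move=> atA irrA f [f0 fnu firr].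
have [sf|sf] := leqP (size f) 1.
  have [c cE] : exists c, f = c%:P by exists (f`_0); apply: size1_polyC.
  rewrite cE; apply/prime_polyC/irrA; split.
  - by apply: contraNneq f0 => c0; rewrite cE c0.
  - by rewrite -polyC_unit -cE.
  - move=> a b ab; rewrite -(polyC_unit a) -(polyC_unit b); apply: firr.
    by rewrite cE ab polyCM.
split=> // g h [k hk].
(* The relation [%|] permits a nonzero constant factor on the dividend; Gauss' lemma removes it,
   since [f] is irreducible of positive degree. *)
have pseudo_dvd (q : {poly A}) : f %| q -> divides f q.
  move=> /Pdiv.Idomain.dvdpP [[c t] /= c0 /(gauss_clear atA irrA c0)].
  move=> [c1 [c2 [t' [f' [c10 c20 tE fE qE]]]]].
  have: f = c2%:P * f' by rewrite mul_polyC.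
  case/firr => [|/size_poly_unit sf'].
    rewrite polyC_unit => uc2; exists (c2^-1 *: t').
    by rewrite fE -scalerAl -scalerAr scalerA mulVr // scale1r.
  by move: sf; rewrite fE size_scale // sf'.
suff: f %| g \/ f %| h by case=> /pseudo_dvd; [left | right].
have /Pdiv.Idomain.dvdpP [[c t] /= c0] := dvdp_gcdl f g.
move=> /(gauss_clear atA irrA c0) [c1 [c2 [t' [d' [c10 c20 tE dE qE]]]]].
case: (firr _ _ qE) => [ut|/size_poly_unit su]; [left | right].
  apply: dvdp_trans (dvdp_gcdr f g); rewrite dE dvdpZr // qE.
  by rewrite -[X in _ %| X](mulKr ut) dvdp_mull.
have cfg : coprimep f g by rewrite coprimep_def dE size_scale // su.
by rewrite -(Gauss_dvdpr _ cfg) hk dvdp_mull.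
Qed.

(** * Factorization of polynomials in several variables *)

Section MpolyUFD.
Variables (K : fieldType).

Lemma mpoly_unitE n (p : {mpoly K[n]}) : (p \is a GRing.unit) = (msize p == 1%N).
Proof.
apply/idP/idP => [/unitrP[q [qp _]]|/msize_poly1P[c c0 ->]].
  have p0 : p != 0 by apply: contraTneq (oner_neq0 {mpoly K[n]}) => p0;
    rewrite -qp p0 mulr0 eqxx.
  have q0 : q != 0 by apply: contraTneq (oner_neq0 {mpoly K[n]}) => q0;
    rewrite -qp q0 mul0r eqxx.
  have := msizeM q0 p0; rewrite qp msize1 (mpolySpred _ q0) (mpolySpred _ p0).
  rewrite addSn addnS /= => /eqP; rewrite eqSS eq_sym addn_eq0.
  by case/andP=> _ /eqP->.
by apply/unitrP; exists (c^-1)%:MP; rewrite -!mpolyCM mulVf // mulfV.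
Qed.

(** Induction on [msize]: the sizes of two factors add up to one more than that of the product, so
    two nonunit factors are both smaller. *)
Lemma mpoly_atomic n : atomic {mpoly K[n]}.
Proof.
move=> a; move: {2}(msize a) (leqnn (msize a)) => k.
elim: k a => [|k IH] a ha a0; first by rewrite (mpolySpred _ a0) in ha.
have [ua|nua] := boolP (a \is a GRing.unit).
  by exists a, [::]; rewrite big_nil mulr1.
have [ia|] := pselect (irreducible_elt a).
  exists 1, [:: a]; rewrite unitr1 big_seq1 mul1r; split=> // p.
  by rewrite inE => /eqP ->.
move=> nia.
have [b [c [abc nub nuc]]] : exists b c,
    [/\ a = b * c, b \isn't a GRing.unit & c \isn't a GRing.unit].
  apply: contrapT => nex; apply: nia; split=> // b c abc.
  have [ub|nub] := boolP (b \is a GRing.unit); first by left.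
  have [uc|nuc] := boolP (c \is a GRing.unit); first by right.
  by case: nex; exists b, c.
have b0 : b != 0 by apply: contraNneq a0 => b0; rewrite abc b0 mul0r.
have c0 : c != 0 by apply: contraNneq a0 => c0; rewrite abc c0 mulr0.
have := msizeM b0 c0; rewrite -abc => sabc.
move: nub nuc; rewrite !mpoly_unitE => sb sc.
have b1 : (1 < msize b)%N by rewrite ltn_neqAle eq_sym sb (mpolySpred _ b0).
have c1 : (1 < msize c)%N by rewrite ltn_neqAle eq_sym sc (mpolySpred _ c0).
have [|u [s [uu hs es]]] := IH b _ b0.
  by rewrite -ltnS; apply: leq_trans ha; rewrite sabc; lia.
have [|v [t [uv ht et]]] := IH c _ c0.
  by rewrite -ltnS; apply: leq_trans ha; rewrite sabc; lia.
exists (u * v), (s ++ t); split; first by rewrite unitrM uu uv.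
  by move=> p; rewrite mem_cat => /orP[/hs|/ht].
by rewrite big_cat /= abc es et mulrACA.
Qed.

(** Inverse of [muni], which singles out the last variable; the pair transports primality from
    univariate polynomials over [{mpoly K[n]}]. *)
Definition un_muni n (q : {poly {mpoly K[n]}}) : {mpoly K[n.+1]} :=
  (map_poly (@mwiden n K) q).['X_ord_max].

Lemma un_muniM n : {morph @un_muni n : p q / p * q}.
Proof. by move=> p q; rewrite /un_muni rmorphM hornerM. Qed.

Lemma muniX n (m : 'X_{1..n.+1}) :
  muni 'X_[K, m] =
  'X_[[multinom m (widen_ord (leqnSn n) i) | i < n]] *: 'X^(m ord_max).
Proof. by rewrite muniE msuppX big_seq1 mcoeffX eqxx scale1r. Qed.

Lemma muni_mwiden n (c : {mpoly K[n]}) : muni (mwiden c) = c%:P.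
Proof.
elim/mpolyind: c => [|a m p _ _ IH]; first by rewrite !raddf0.
rewrite mwidenD muniD polyCD IH; congr (_ + _).
rewrite mwidenZ mwidenX muniZ muniX mnmwiden_ordmax expr0.
rewrite -mul_mpolyC polyCM -!mul_polyC mulr1; congr (_ * _%:P); congr 'X_[_].
by apply/mnmP => i; rewrite mnmE mnmwiden_widen.
Qed.

Lemma un_muniD n : {morph @un_muni n : p q / p + q}.
Proof. by move=> p q; rewrite /un_muni rmorphD hornerD. Qed.

Lemma un_muniK n : cancel (@un_muni n) (@muni n K).
Proof.
elim/poly_ind => [|p c IH]; first by rewrite /un_muni rmorph0 horner0 muni0.
rewrite un_muniD un_muniM muniD muniM IH; congr (_ * _ + _).
  rewrite /un_muni map_polyX hornerX muniX mnmE eqxx expr1.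
  rewrite (_ : [multinom _ | _ < n] = 0%MM) ?mpolyX0 ?scale1r //.
  apply/mnmP => i; rewrite !mnmE; apply/eqP; rewrite eqb0.
  by apply/eqP => /(congr1 val) /= /eqP; rewrite gtn_eqF.
by rewrite /un_muni map_polyC hornerC muni_mwiden.
Qed.

Lemma muniK n : cancel (@muni n K) (@un_muni n).
Proof.
elim/mpolyind => [|a m p _ _ IH]; first by rewrite muni0 /un_muni rmorph0 horner0.
rewrite muniD un_muniD [X in _ + X]IH; congr (_ + _).
rewrite muniZ muniX.
rewrite /un_muni -!mul_polyC !rmorphM hornerM /= !map_polyC map_polyXn /=.
rewrite hornerM !hornerC hornerXn mwidenC mwidenX -mul_mpolyC; congr (_ * _).
rewrite mpolyXn -mpolyXD; congr 'X_[_]; apply/mnmP => i.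
rewrite mnmDE mulmnE mnmE; case: (unliftP ord_max i) => [j|] ->.
  rewrite (_ : lift ord_max j = widen_ord (leqnSn n) j); last first.
    by apply/val_inj; rewrite /= /bump leqNgt ltn_ord.
  rewrite mnmwiden_widen mnmE -(inj_eq val_inj) /= gtn_eqF ?ltn_ord //.
  by rewrite mul0n addn0.
by rewrite mnmwiden_ordmax eqxx mul1n.
Qed.

Lemma muni_unit n (p : {mpoly K[n.+1]}) :
  (muni p \is a GRing.unit) = (p \is a GRing.unit).
Proof.
apply/idP/idP => /unitrP[q [qp pq]]; apply/unitrP.
  by exists (un_muni q); rewrite -[p]muniK -!un_muniM qp pq -(muni1 n K) muniK.
exists (muni q); split.
  exact: etrans (esym (muniM q p)) (etrans (congr1 _ qp) (muni1 n K)).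
exact: etrans (esym (muniM p q)) (etrans (congr1 _ pq) (muni1 n K)).
Qed.

(** Induction on the number of variables, through [{poly {mpoly K[n]}}]; without variables every
    nonzero polynomial is a unit. *)
Lemma mpoly_irreducible_prime n (p : {mpoly K[n]}) :
  irreducible_elt p -> prime_elt p.
Proof.
elim: n p => [|n IH] p [p0 pnu pirr].
  have := nvar0_mpolyC p; move: (p@_0)%MM => c pc.
  by move: pnu p0; rewrite pc mpoly_unitE msizeC mpolyC_eq0; case: (c == 0).
have [_ pp] : prime_elt (muni p).
  apply: (poly_irreducible_prime (@mpoly_atomic n) (IH)); split.
  - by rewrite -(muni0 n K) (inj_eq (can_inj (@muniK n))).
  - by rewrite muni_unit.
  - move=> b c /(congr1 (@un_muni n)); rewrite muniK un_muniM => /pirr.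
    by rewrite -!muni_unit !un_muniK.
split=> // b c [e he].
have /pp[[q hq]|[q hq]] : divides (muni p) (muni b * muni c).
  exists (muni e).
  exact: etrans (esym (muniM b c)) (etrans (congr1 _ he) (muniM e p)).
- left; exists (un_muni q); rewrite -[b in LHS]muniK hq un_muniM.
  by congr (_ * _); apply: muniK.
- right; exists (un_muni q); rewrite -[c in LHS]muniK hq un_muniM.
  by congr (_ * _); apply: muniK.
Qed.

(* Normalising the leading coefficient picks one irreducible in each class of
   associates. *)
Definition monic_irreducible n (p : {mpoly K[n]}) : Prop :=
  irreducible_elt p /\ mleadc p = 1.

Lemma monic_irreducible_dvd n (p q : {mpoly K[n]}) :
  monic_irreducible p -> monic_irreducible q -> divides p q -> p = q.
Proof.
move=> [[p0 pnu _] p1] [[q0 _ qirr] q1] [c qE].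
case: (qirr _ _ qE) => [uc|]; last by rewrite (negbTE pnu).
move: uc; rewrite mpoly_unitE => /msize_poly1P[a a0 ac].
have := mleadcZE a p; rewrite -mul_mpolyC -ac -qE q1 p1 mulr1 => a1.
by rewrite qE ac -a1 mpolyC1 mul1r.
Qed.

(** [p] is prime, so it divides some [q] of positive exponent, and a monic irreducible dividing
    another equals it. *)
Lemma monic_irreducible_dvd_prod n (p : {mpoly K[n]}) (P : seq {mpoly K[n]})
    (e : {mpoly K[n]} -> nat) (c : K) :
  monic_irreducible p -> (forall q, q \in P -> monic_irreducible q) -> c != 0 ->
  divides p (c *: \prod_(q <- P) q ^+ e q) -> p \in P /\ (0 < e p)%N.
Proof.
move=> mp mP c0; have [pp0 pp] := mpoly_irreducible_prime mp.1.
have pN1 (a : K) : a != 0 -> ~ divides p a%:MP.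
  move=> a0 [h hE]; case: mp => -[_ /negP nu _] _; case: nu.
  have hp : (a^-1%:MP * h) * p = 1.
    by rewrite -mulrA -hE -mpolyCM mulVf // mpolyC1.
  by apply/unitrP; exists (a^-1%:MP * h); split=> //; rewrite mulrC.
elim: P mP => [|q P IH] mP.
  by rewrite big_nil -mul_mpolyC mulr1 => /(pN1 _ c0).
have mP' q' : q' \in P -> monic_irreducible q'.
  by move=> h; apply: mP; rewrite inE h orbT.
rewrite big_cons scalerAr => /pp[]; last first.
  by case/(IH mP') => pP ep; rewrite inE pP orbT.
case: (posnP (e q)) => [-> |eq]; first by rewrite expr0 -mpolyC1 => /(pN1 _ (oner_neq0 _)).
have: forall k, divides p (q ^+ k) -> p = q.
  elim=> [|k IHk]; first by rewrite expr0 -mpolyC1 => /(pN1 _ (oner_neq0 _)).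
  rewrite exprS => /pp[|//].
  by apply: monic_irreducible_dvd => //; apply/mP/mem_head.
by move=> h /h ->; rewrite mem_head.
Qed.

Lemma mpoly_factor n (f : {mpoly K[n]}) : f != 0 ->
  exists (c : K) (s : seq {mpoly K[n]}),
    [/\ c != 0, forall p, p \in s -> monic_irreducible p &
        f = c *: \prod_(p <- s) p].
Proof.
have monicP p : irreducible_elt p -> exists2 a, a != 0 &
    exists2 q : {mpoly K[n]}, monic_irreducible q & p = a *: q.
  move=> [p0 pnu pirr]; have l0 : mleadc p != 0 by rewrite mleadc_eq0.
  exists (mleadc p) => //; exists ((mleadc p)^-1 *: p); last first.
    by rewrite scalerA mulfV // scale1r.
  split; last by rewrite mleadcZE mulVf.
  have u : ((mleadc p)^-1)%:MP \is a @GRing.unit {mpoly K[n]}.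
    by rewrite mpoly_unitE msizeC invr_eq0 l0.
  rewrite -mul_mpolyC; split.
  - by rewrite mulf_neq0 // mpolyC_eq0 invr_eq0.
  - by rewrite unitrMr.
  - move=> b c e; case: (pirr ((mleadc p)%:MP * b) c).
    + by rewrite -mulrA -e mulrA -mpolyCM mulfV // mpolyC1 mul1r.
    + by rewrite unitrM => /andP[_]; left.
    + by right.
move=> /mpoly_atomic [u [s [uu irs ->]]].
have [a a0 ua] : exists2 a, a != 0 & u = a%:MP.
  by move: uu; rewrite mpoly_unitE => /msize_poly1P.
suff [c [t [c0 mt ->]]] : exists c t, [/\ c != 0,
    forall p, p \in t -> monic_irreducible p &
    \prod_(p <- s) p = c *: \prod_(p <- t) p].
  by exists (a * c), t; rewrite mulf_neq0 // ua mul_mpolyC scalerA.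
elim: s irs {uu ua} => [|p s IH] irs.
  by exists 1, [::]; rewrite oner_neq0 scale1r !big_nil.
have [b b0 [q mq pq]] := monicP p (irs _ (mem_head _ _)).
have [|c [t [c0 mt tE]]] := IH; first by
  move=> x xs; apply: irs; rewrite inE xs orbT.
exists (b * c), (q :: t); rewrite mulf_neq0 //; split=> //.
  by move=> x; rewrite inE => /orP[/eqP->|/mt].
by rewrite !big_cons tE pq -scalerAl -scalerAr scalerA.
Qed.

Lemma monic_irreducible_factor n (h : {mpoly K[n]}) :
  h != 0 -> h \isn't a GRing.unit ->
  exists2 p, monic_irreducible p & divides p h.
Proof.
move=> /mpoly_factor[c [[|p s] [c0 ms hE]]] hnu.
  by move: hnu; rewrite hE big_nil -mul_mpolyC mulr1 mpoly_unitE msizeC c0.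
exists p; first exact/ms/mem_head.
by exists (c *: \prod_(q <- s) q); rewrite hE big_cons mulrC scalerAl.
Qed.

(** One list [P] serves all the [f i], with exponent [0] allowed, so that orders can be compared
    prime by prime. *)
Lemma common_factorization n (I : finType) (f : I -> {mpoly K[n]}) :
  (forall i, f i != 0) ->
  exists (P : seq {mpoly K[n]}) (e : I -> {mpoly K[n]} -> nat) (c : I -> K),
    [/\ uniq P, forall p, p \in P -> monic_irreducible p,
        forall i, c i != 0 & forall i, f i = c i *: \prod_(p <- P) p ^+ e i p].
Proof.
move=> f0; have /all_sig[cs csP] i : {cs : K * seq {mpoly K[n]} |
    [/\ cs.1 != 0, forall p, p \in cs.2 -> monic_irreducible p &
        f i = cs.1 *: \prod_(p <- cs.2) p]}.
  by apply: cid; have [c [s h]] := mpoly_factor (f0 i); exists (c, s).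
pose s := flatten [seq (cs i).2 | i <- enum I].
have sub i p : p \in (cs i).2 -> p \in undup s.
  move=> pi; rewrite mem_undup; apply/flattenP; exists (cs i).2 => //.
  by apply: map_f; rewrite mem_enum.
exists (undup s), (fun i p => count_mem p (cs i).2), (fun i => (cs i).1).
split=> [||i|i]; first exact: undup_uniq.
- move=> p; rewrite mem_undup => /flattenP[t /mapP[i _ ->]].
  by case: (csP i) => _ + _; apply.
- by case: (csP i).
case: (csP i) => _ _ ->; congr (_ *: _).
have: {subset (cs i).2 <= undup s} by move=> p; apply: sub.
elim: (cs i).2 => [|q t IH] subt.
  by rewrite big_nil big1_seq.
rewrite big_cons IH; last by move=> p pt; apply: subt; rewrite inE pt orbT.
(* The extra occurrence of [q] is spread over [undup s] as a factor that is [1] except at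
   [p = q]. *)
rewrite [in RHS](eq_bigr (fun p => (if q == p then p else 1) * p ^+ count_mem p t)).
  rewrite big_split /= -big_mkcond /=; congr (_ * _).
  rewrite -big_filter (_ : filter _ _ = [:: q]) ?big_seq1 //.
  have qs : q \in undup s by apply: subt; rewrite mem_head.
  rewrite (eq_filter (a2 := pred1 q)); last by move=> p /=; rewrite eq_sym.
  by rewrite filter_pred1_uniq // undup_uniq.
by move=> p _ /=; case: eqP => _; rewrite ?mul1r // exprD expr1.
Qed.

(** If the exponents of [q] differed, cancelling the smaller power would make [q] divide a product
    of other primes. *)
Lemma exponent_uniq n (P : seq {mpoly K[n]}) (e e' : {mpoly K[n]} -> nat)
    (c c' : K) :
  uniq P -> (forall p, p \in P -> monic_irreducible p) -> c != 0 -> c' != 0 ->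
  c *: \prod_(p <- P) p ^+ e p = c' *: \prod_(p <- P) p ^+ e' p ->
  {in P, e =1 e'}.
Proof.
move=> uP mP c0 c0' he q qP.
have q0 : q != 0 by case: (mP q qP) => -[].
have other (b : K) (g : {mpoly K[n]} -> nat) : b != 0 ->
    ~ divides q (b *: \prod_(p <- rem q P) p ^+ g p).
  move=> b0 /(monic_irreducible_dvd_prod (mP q qP)) [] //.
    by move=> p /mem_rem; apply: mP.
  by rewrite mem_rem_uniqF.
move: he; rewrite !(perm_big _ (perm_to_rem qP)) /= !big_cons.
set x := \prod_(_ <- _) _; set y := \prod_(_ <- _) _.
rewrite !scalerAr => he.
have key (a b : nat) (u v : {mpoly K[n]}) : q ^+ a * u = q ^+ b * v ->
    (a < b)%N -> divides q u.
  move=> h ab; exists (q ^+ (b - a.+1) * v).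
  apply: (mulfI (expf_neq0 a q0)); rewrite h -{1}(subnKC ab) exprD exprSr.
  by rewrite -!mulrA (mulrCA q) (mulrC q v).
case: (ltngtP (e q) (e' q)) => // lt.
  by have /(other _ _ c0) := key _ _ _ _ he lt.
by have /(other _ _ c0') := key _ _ _ _ (esym he) lt.
Qed.

End MpolyUFD.

(** * Cones and fans *)

Section Dot.
Variables (K : comNzRingType) (n : nat).
Implicit Types u v w : 'rV[K]_n.

Lemma dotC u v : dot u v = dot v u.
Proof. by apply: eq_bigr => j _; rewrite mulrC. Qed.

Lemma dotDr u v w : dot u (v + w) = dot u v + dot u w.
Proof. by rewrite -big_split; apply: eq_bigr => j _; rewrite mxE mulrDr. Qed.

Lemma dotZr a u v : dot u (a *: v) = a * dot u v.
Proof. by rewrite mulr_sumr; apply: eq_bigr => j _; rewrite mxE mulrCA. Qed.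

Lemma dotZl a u v : dot (a *: u) v = a * dot u v.
Proof. by rewrite dotC dotZr dotC. Qed.

Lemma dotNr u v : dot u (- v) = - dot u v.
Proof. by rewrite -scaleN1r dotZr mulN1r. Qed.

Lemma dotBr u v w : dot u (v - w) = dot u v - dot u w.
Proof. by rewrite dotDr dotNr. Qed.

Lemma dotBl u v w : dot (u - v) w = dot u w - dot v w.
Proof. by rewrite dotC dotBr !(dotC w). Qed.

Lemma dot0r u : dot u 0 = 0.
Proof. by rewrite -(scale0r 0) dotZr mul0r. Qed.

Lemma dot0l u : dot 0 u = 0.
Proof. by rewrite dotC dot0r. Qed.

Lemma dot_sumr (I : Type) (s : seq I) (P : pred I) (F : I -> 'rV[K]_n) u :
  dot u (\sum_(i <- s | P i) F i) = \sum_(i <- s | P i) dot u (F i).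
Proof. by apply: (big_morph (dot u)); [exact: dotDr | exact: dot0r]. Qed.

Lemma dot_suml (I : Type) (s : seq I) (P : pred I) (F : I -> 'rV[K]_n) u :
  dot (\sum_(i <- s | P i) F i) u = \sum_(i <- s | P i) dot (F i) u.
Proof. by rewrite dotC dot_sumr; apply: eq_bigr => i _; rewrite dotC. Qed.

Lemma dot_delta u j : dot u (delta_mx 0 j) = u 0 j.
Proof.
rewrite /dot (bigD1 j) //= big1 => [|i ij]; last by rewrite mxE (negbTE ij) andbF mulr0.
by rewrite mxE !eqxx mulr1 addr0.
Qed.

End Dot.

Section Lattice.
Variables (R : realType) (n : nat).
Implicit Types u v : 'rV[int]_n.

Lemma lattD u v : latt R (u + v) = latt R u + latt R v.
Proof. by apply/rowP => j; rewrite !mxE intrD. Qed.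

Lemma lattZ a u : latt R (a *: u) = a%:~R *: latt R u.
Proof. by apply/rowP => j; rewrite !mxE intrM. Qed.

Lemma latt0 : latt R (0 : 'rV_n) = 0.
Proof. by apply/rowP => j; rewrite !mxE. Qed.

Lemma latt_sum (I : Type) (s : seq I) (P : pred I) (F : I -> 'rV[int]_n) :
  latt R (\sum_(i <- s | P i) F i) = \sum_(i <- s | P i) latt R (F i).
Proof. by apply: (big_morph (@latt R n)); [exact: lattD | exact: latt0]. Qed.

Lemma latt_inj : injective (@latt R n).
Proof.
by move=> u v /rowP e; apply/rowP => j; have := e j; rewrite !mxE => /intr_inj.
Qed.

Lemma dot_latt u v : dot (latt R u) (latt R v) = (dot u v)%:~R.
Proof. by rewrite /dot rmorph_sum; apply: eq_bigr => j _; rewrite /= !mxE intrM. Qed.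

End Lattice.

(* Bartl's proof: if a functional [z] violates the conclusion for the tail, the
   generator [g i] is positive on it and can be used to project everything to
   the hyperplane [g i = 0]. *)
Lemma farkas (F : realFieldType) (n : nat) (I : eqType) (s : seq I)
    (g : I -> 'rV[F]_n) (x : 'rV[F]_n) :
  uniq s ->
  (forall u, (forall i, i \in s -> 0 <= dot u (g i)) -> 0 <= dot u x) ->
  exists c : I -> F, (forall i, 0 <= c i) /\ x = \sum_(i <- s) c i *: g i.
Proof.
elim: s g x => [|i s IH] g x us hx.
  have hx' u : 0 <= dot u x by apply: hx.
  exists (fun=> 0); split=> //; rewrite big_nil; apply/rowP => j.
  have := hx' (- delta_mx 0 j); have := hx' (delta_mx 0 j).
  rewrite !(dotC _ x) dotNr dot_delta oppr_ge0 mxE => a b.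
  by apply/eqP; rewrite eq_le a b.
move: us => /= /andP[inots us].
have upd (c : I -> F) a (h : I -> 'rV[F]_n) :
    \sum_(j <- s) (if j == i then a else c j) *: h j = \sum_(j <- s) c j *: h j.
  apply: eq_big_seq => j js; case: eqP => // ji.
  by rewrite ji (negbTE inots) in js.
have [hs|nhs] := pselect (forall u,
    (forall j, j \in s -> 0 <= dot u (g j)) -> 0 <= dot u x).
  have [c [c0 xE]] := IH g x us hs.
  exists (fun j => if j == i then 0 else c j); split.
    by move=> j; case: ifP.
  by rewrite big_cons eqxx scale0r add0r upd.
have [z [zs zx]] : exists z, (forall j, j \in s -> 0 <= dot z (g j)) /\
    dot z x < 0.
  apply: contrapT => hn; apply: nhs => u hu; rewrite leNgt; apply/negP => ux.
  by apply: hn; exists u.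
have zi : dot z (g i) < 0.
  rewrite ltNge; apply/negP => zi; move: zx; rewrite ltNge; case/negP.
  by apply: hx => j; rewrite inE => /orP[/eqP->|/zs].
pose pr y := y - (dot z y / dot z (g i)) *: g i.
have prE u y : dot u (pr y) = dot (u - (dot u (g i) / dot z (g i)) *: z) y.
  by rewrite dotBr dotZr dotBl dotZl; congr (_ - _); rewrite mulrAC [RHS]mulrAC (mulrC (dot z y)).
have [|c [c0 prx]] := IH (pr \o g) (pr x) us _; last first.
  pose a := dot z x / dot z (g i) - \sum_(j <- s) c j * (dot z (g j) / dot z (g i)).
  exists (fun j => if j == i then a else c j); split.
    move=> j; case: eqP => // _; rewrite /a subr_ge0.
    apply: (@le_trans _ _ 0).
      rewrite big_seq; apply: sumr_le0 => l ls; apply: mulr_ge0_le0 => //.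
      by apply: mulr_ge0_le0; rewrite ?zs ?invr_le0 ?ltW.
    by apply: mulr_le0; rewrite ?invr_le0 ltW.
  rewrite big_cons eqxx upd /a scalerBl.
  have xE : x = pr x + (dot z x / dot z (g i)) *: g i by rewrite subrK.
  apply: (etrans xE); rewrite addrC -addrA; congr (_ + _).
  rewrite prx addrC scaler_suml -sumrB; apply: eq_bigr => j _.
  by rewrite scalerBr scalerA.
move=> u hu; rewrite prE; apply: hx => j.
rewrite inE => /orP[/eqP->|js]; last by rewrite -prE hu.
by rewrite dotBl dotZl divfK ?subrr // lt_eqF.
Qed.

(** Pigeonhole principle, used to find one cone of the fan containing infinitely many terms of a
    sequence. *)
Lemma frequent_value (T : eqType) (s : seq T) (P : T -> nat -> Prop) :
  (forall N, exists2 t, t \in s & P t N) ->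
  exists2 t, t \in s & forall M, exists2 N, (M <= N)%N & P t N.
Proof.
elim: s P => [|t s IH] P hP; first by have [] := hP 0.
have [ht|nht] := pselect (forall M, exists2 N, (M <= N)%N & P t N).
  by exists t => //; apply: mem_head.
have [M hM] : exists M, forall N, (M <= N)%N -> ~ P t N.
  apply: contrapT => h; apply: nht => M; apply: contrapT => h'.
  by apply: h; exists M => N MN PN; apply: h'; exists N.
have [N|t' t's h] := IH (fun t N => P t (M + N)%N).
  have [t'] := hP (M + N)%N; rewrite inE => /orP[/eqP-> /hM|]; last by exists t'.
  by rewrite leq_addr => /(_ isT).
exists t'; first by rewrite inE t's orbT.
move=> M'; have [N N' PN] := h M'; exists (M + N)%N => //.
exact: leq_trans N' (leq_addl _ _).
Qed.

Lemma poly_frequent_root (F : idomainType) (p : {poly F}) (f : nat -> F) :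
  injective f -> (forall M, exists2 N, (M <= N)%N & root p (f N)) -> p = 0.
Proof.
move=> fI hp.
have ex k : exists s : seq nat, [/\ uniq s, size s = k & all (root p \o f) s].
  elim: k => [|k [s [us ss sr]]]; first by exists [::].
  have [N N0 rN] := hp (\max_(i <- s) i).+1.
  exists (N :: s); rewrite /= us ss rN sr andbT; split=> //.
  by apply/negP => Ns; move: N0; rewrite ltnNge; case/negP; apply: (leq_bigmax_seq N).
apply/eqP/negPn/negP => p0; have [s [us ss sr]] := ex (size p).
have := @max_poly_roots _ p (map f s) p0; rewrite all_map sr map_inj_uniq // us.
by rewrite size_map ss ltnn => /(_ isT isT).
Qed.

(** * Cones of a smooth complete fan *)

Section Fan.
Variables (R : realType) (n r : nat) (Sigma : set (set 'rV[R]_n)).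
Variables (rho : 'I_r -> set 'rV[R]_n) (nu : 'I_r -> 'rV[int]_n).
Hypotheses (fan_Sigma : is_fan Sigma) (complete_Sigma : complete_fan Sigma)
  (edges_rho : edges_of Sigma rho)
  (first_nu : forall i, first_lattice_vector (rho i) (nu i))
  (smooth_Sigma : smooth_fan Sigma nu).
Implicit Types (sigma tau : set 'rV[R]_n) (u v w x : 'rV[R]_n).

Local Notation L i := (latt R (nu i)).

Lemma fan_cone sigma : Sigma sigma -> rational_polyhedral_cone sigma.
Proof. by case: fan_Sigma => _ h _ _ /h[]. Qed.

Lemma cone0 sigma : rational_polyhedral_cone sigma -> sigma 0.
Proof.
case=> k [g ->]; exists (fun=> 0); split=> //.
by rewrite big1 // => i _; rewrite scale0r.
Qed.

Lemma coneD sigma v w : rational_polyhedral_cone sigma ->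
  sigma v -> sigma w -> sigma (v + w).
Proof.
case=> k [g ->] [c [c0 ->]] [d [d0 ->]]; exists (fun i => c i + d i); split.
  by move=> i; apply: addr_ge0.
by rewrite -big_split; apply: eq_bigr => i _; rewrite scalerDl.
Qed.

Lemma coneZ sigma (a : R) v : rational_polyhedral_cone sigma ->
  0 <= a -> sigma v -> sigma (a *: v).
Proof.
case=> k [g ->] a0 [c [c0 ->]]; exists (fun i => a * c i); split.
  by move=> i; apply: mulr_ge0.
by rewrite scaler_sumr; apply: eq_bigr => i _; rewrite scalerA.
Qed.

Lemma cone_sum sigma (I : Type) (s : seq I) (P : pred I) (F : I -> 'rV[R]_n) :
  rational_polyhedral_cone sigma -> (forall i, P i -> sigma (F i)) ->
  sigma (\sum_(i <- s | P i) F i).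
Proof.
move=> cs hF; apply: (big_ind sigma) => //; first exact: cone0.
by move=> x y; apply: coneD.
Qed.

(** By Farkas' lemma a finitely generated cone is the intersection of the half-spaces containing it;
    closedness of cones is used in this form. *)
Lemma cone_bidual sigma x : rational_polyhedral_cone sigma ->
  (forall u, (forall v, sigma v -> 0 <= dot u v) -> 0 <= dot u x) -> sigma x.
Proof.
case=> k [g ->] hx.
have [|c [c0 ->]] := @farkas _ _ _ (enum 'I_k) (latt R \o g) x (enum_uniq _).
  move=> u hu; apply: hx => v [c [c0 ->]]; rewrite dot_sumr sumr_ge0 // => i _.
  by rewrite dotZr mulr_ge0 // hu ?mem_enum.
by exists c; split=> //; rewrite big_enum.
Qed.

(* The points [x + w N / N] tend to [x], and a cone is closed. *)
Lemma cone_limit sigma x (w : nat -> 'rV[R]_n) : rational_polyhedral_cone sigma ->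
  (forall u, exists B, forall N, dot u (w N) <= B) ->
  (forall M, exists2 N, (M <= N)%N & sigma (N%:R *: x + w N)) -> sigma x.
Proof.
move=> cs bw hx; apply: cone_bidual => // u hu; rewrite leNgt; apply/negP => ux.
have [B hB] := bw u; pose a := - dot u x.
have a0 : 0 < a by rewrite oppr_gt0.
(* For [N >= M] the product [N a] exceeds [B], so [u] is negative at [N x + w N]. *)
pose M := Num.bound `|B / a|.
have BM : B < M%:R * a.
  rewrite -ltr_pdivrMr //; apply: le_lt_trans (ler_norm _) _.
  exact: archi_boundP (normr_ge0 _).
have [N MN /hu] := hx M; rewrite dotDr dotZr.
apply/negP; rewrite -ltNge -(opprK (dot u x)) -/a mulrN addrC subr_lt0.
apply: le_lt_trans (hB N) (lt_le_trans BM _).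
by rewrite ler_pM2r // ler_nat.
Qed.

(** If the matrix of generators has rank [n], some of its rows form a basis; otherwise a nonzero
    column of its cokernel is a functional vanishing on the cone. *)
Lemma cone_full_or_hyperplane sigma : rational_polyhedral_cone sigma ->
  cone_dim sigma n \/ exists2 u, u != 0 & forall v, sigma v -> dot u v = 0.
Proof.
case=> k [g sE]; pose G : 'M[R]_(k, n) := \matrix_i latt R (g i).
have sg i : sigma (latt R (g i)).
  rewrite sE; exists (fun j => (j == i)%:R); split; first by move=> j; rewrite ler0n.
  rewrite (bigD1 i) //= eqxx scale1r big1 ?addr0 // => j ji.
  by rewrite (negbTE ji) scale0r.
have [fG|nfG] := boolP (row_full G); [left|right].
  exists (rowsub (fullrankfun fG) G); split.
  - exact: fullrowsub_free.
  - by move=> i; rewrite row_rowsub rowK.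
  - by move=> v _; apply: submx_full; rewrite fullrowsub_full.
have : cokermx G != 0.
  by apply: contra nfG => /eqP c0; rewrite -cokermx_eq0 c0.
case/matrix0Pn => i [j cij]; exists (col j (cokermx G))^T.
  by apply: contra cij => /eqP /rowP /(_ i); rewrite !mxE => ->.
move=> v; rewrite sE => -[c [c0 ->]]; rewrite dot_sumr big1 // => l _.
have := congr1 (fun A : 'M_(k, n) => A l j) (mulmx_coker G).
rewrite !mxE dotZr => h; rewrite (_ : dot _ _ = 0) ?mulr0 //.
by rewrite -[RHS]h; apply: eq_bigr => t _; rewrite !mxE mulrC.
Qed.

Lemma fan_seq : exists s : seq (set 'rV[R]_n), Sigma = [set` s].
Proof. by case: fan_Sigma => /finite_seqP. Qed.

Lemma fan_cover x : exists2 sigma, Sigma sigma & sigma x.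
Proof.
have : [set: 'rV[R]_n] x by [].
by rewrite -complete_Sigma => -[sigma]; exists sigma.
Qed.

(* Finitely many proper subspaces meet the moment curve through [x] in finitely
   many points. *)
Lemma fan_full_cover x :
  exists2 sigma, Sigma sigma & cone_dim sigma n /\ sigma x.
Proof.
have [s sE] := fan_seq.
(* [N.+1%:R *: x + w N] is [N + 1] times the point with parameter [e N] on the moment curve
   [x + (e, e^2, ...)], and [w] stays bounded. *)
pose e (N : nat) : R := N.+1%:R^-1.
pose w N : 'rV[R]_n := \row_(j < n) e N ^+ j.
have [N|tau ts ht] := @frequent_value _ s (fun tau N => tau (N.+1%:R *: x + w N)).
  have [tau St tx] := fan_cover (N.+1%:R *: x + w N).
  by exists tau => //; rewrite sE in St.
have St : Sigma tau by rewrite sE.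
exists tau => //; split; last first.
  apply: (@cone_limit _ _ (fun N => w N.-1)); first exact: fan_cone.
    move=> u; exists (\sum_j `|u 0 j|) => N; apply: ler_sum => j _.
    rewrite mxE; apply: le_trans (ler_norm _) _; rewrite normrM ler_piMr //.
    rewrite normrX exprn_ile1 // ger0_norm ?invr_ge0 ?ler0n //.
    by rewrite invf_le1 ?ltr0Sn // ler1n.
  by move=> M; have [N MN h] := ht M; exists N.+1; first exact: leqW.
have [//|[u u0 hu]] := cone_full_or_hyperplane (fan_cone St).
(* [p] is [u] along the moment curve; it has infinitely many roots [e N], and its coefficients
   contain the entries of [u]. *)
pose p := (dot u x)%:P + \sum_(j < n) (u 0 j)%:P * 'X^(j.+1).
have p0 : p = 0.
  apply: (@poly_frequent_root _ p e).
    by move=> a b /invr_inj /eqP; rewrite eqr_nat => /eqP[].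
  move=> M; have [N MN /hu h] := ht M; exists N => //; apply/rootP.
  have N0 : N.+1%:R != 0 :> R by rewrite pnatr_eq0.
  apply: (mulfI N0); rewrite mulr0 -[RHS]h dotDr dotZr /p hornerD hornerC mulrDr.
  congr (_ + _); rewrite horner_sum mulr_sumr; apply: eq_bigr => j _.
  by rewrite mxE hornerM hornerC hornerXn exprS mulrCA mulVKf.
case/negP: u0; apply/eqP/rowP => j; rewrite mxE.
have := congr1 (fun q : {poly R} => q`_j.+1) p0.
rewrite coefD coefC /= add0r coef_sum coef0 (bigD1 j) //= coefCM coefXn eqxx.
rewrite mulr1 big1 ?addr0 // => i ij; rewrite coefCM coefXn eqSS.
by rewrite (inj_eq val_inj) eq_sym (negbTE ij) mulr0.
Qed.

(** One full-dimensional cone contains [N *: x + v] for infinitely many [N], hence also the limit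
    direction [x]: it is a cone entered on leaving [x] towards [v]. *)
Lemma fan_full_cover_dir x v : exists2 sigma, Sigma sigma &
  [/\ cone_dim sigma n, sigma x & exists N : nat, sigma (N%:R *: x + v)].
Proof.
have [s sE] := fan_seq.
have [N|tau ts ht] := @frequent_value _ s
    (fun tau N => cone_dim tau n /\ tau (N%:R *: x + v)).
  have [tau St tx] := fan_full_cover (N%:R *: x + v).
  by exists tau => //; rewrite sE in St.
have St : Sigma tau by rewrite sE.
exists tau => //; have [N _ [td tN]] := ht 0; split=> //; last by exists N.
apply: (@cone_limit _ _ (fun=> v)); first exact: fan_cone.
  by move=> u; exists (dot u v).
by move=> M; have [N' MN' [_ h]] := ht M; exists N'.
Qed.

Lemma ray_neq0 i : L i != 0.
Proof.
have [nu0 _ _] := first_nu i; apply: contra nu0 => /eqP e.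
by apply/eqP; apply: (@latt_inj R n); rewrite latt0.
Qed.

Lemma edge_spec i : Sigma (rho i) /\ cone_dim (rho i) 1.
Proof. by case: edges_rho => h _ _; have := h i I. Qed.

(** An edge lies on a line and is strongly convex, so all its points are nonnegative multiples of
    [L i]. *)
Lemma ray_subset sigma i : Sigma sigma -> (rho i `<=` sigma <-> sigma (L i)).
Proof.
move=> Ss; have [_ Li _] := first_nu i; split; first exact.
move=> sLi v rv; have [Sr [A [_ _ hA]]] := edge_spec i.
have /sub_rVP[a La] := hA _ Li; have /sub_rVP[b vb] := hA _ rv.
have a0 : a != 0 by apply: contraNneq (ray_neq0 i) => a0; rewrite La a0 scale0r.
have vE : v = (b / a) *: L i by rewrite La scalerA divfK.
have [ba|ba] := leP 0 (b / a); first by rewrite vE; apply: coneZ => //; apply: fan_cone.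
suff -> : v = 0 by apply: cone0; apply: fan_cone.
have [_ sc] : rational_polyhedral_cone (rho i) /\ strongly_convex (rho i).
  by case: fan_Sigma => _ h _ _; apply: h.
apply: sc => //; rewrite vE -scaleNr; apply: coneZ => //; first exact: fan_cone.
by rewrite oppr_ge0 ltW.
Qed.

(* The intersection is a face of [sigma], and the functional that cuts it out
   vanishes on each term of a positive combination on which it vanishes. *)
Lemma fan_face_sum sigma tau (I : finType) (A : {set I}) (F : I -> 'rV[R]_n)
    (c : I -> R) : Sigma sigma -> Sigma tau ->
  (forall i, i \in A -> sigma (F i) /\ 0 < c i) ->
  tau (\sum_(i in A) c i *: F i) -> forall i, i \in A -> tau (F i).
Proof.
move=> Ss St hF tF i iA; have [_ _ _ /(_ _ _ Ss St) [[u [u0 tE]] _]] := fan_Sigma.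
have sF : sigma (\sum_(i in A) c i *: F i).
  apply: cone_sum; first exact: fan_cone.
  by move=> j /hF[sj cj]; apply: coneZ; rewrite ?ltW //; apply: fan_cone.
have : (sigma `&` tau) (\sum_(i in A) c i *: F i) by [].
rewrite tE => -[_]; rewrite dot_sumr => /eqP.
rewrite psumr_eq0 => [/allP /(_ i (mem_index_enum i))|j jA]; last first.
  by have [sj cj] := hF j jA; rewrite dotZr mulr_ge0 ?u0 // ltW.
rewrite iA dotZr mulf_eq0 => /orP[|/eqP uF].
  by have [_ ci] := hF i iA; rewrite gt_eqF.
have : (sigma `&` tau) (F i) by rewrite tE; split=> //; have [] := hF i iA.
by case.
Qed.

(* An irredundant generator spans a one-dimensional face, hence an edge of the
   fan: Farkas' lemma separates it from each other generator, and the sum of the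
   functionals obtained cuts out the face. *)
Lemma fan_extremal_ray sigma (k : nat) (g : 'I_k -> 'rV[R]_n) (A : {set 'I_k})
    (j : 'I_k) :
  Sigma sigma ->
  sigma = [set v | exists c : 'I_k -> R,
    (forall i, 0 <= c i) /\ v = \sum_(i in A) c i *: g i] ->
  j \in A ->
  ~ (exists c : 'I_k -> R, (forall i, 0 <= c i) /\
       g j = \sum_(i in A :\ j) c i *: g i) ->
  exists i (t : R), [/\ 0 <= t, sigma (L i) & g j = t *: L i].
Proof.
move=> Ss sE jA irr.
have [[_ Sgc Sf _] cs] := (fan_Sigma, fan_cone Ss).
have scs : strongly_convex sigma by case: (Sgc _ Ss).
have sg i : i \in A -> sigma (g i).
  move=> iA; rewrite sE; exists (fun l => (l == i)%:R); split.
    by move=> l; rewrite ler0n.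
  rewrite (bigD1 i) //= eqxx scale1r big1 ?addr0 // => l /andP[_ li].
  by rewrite (negbTE li) scale0r.
have gj0 : g j != 0.
  apply/eqP => gj0; apply: irr; exists (fun=> 0); split=> //.
  by rewrite gj0 big1 // => i _; rewrite scale0r.
have single (l : 'I_k) (B : {set 'I_k}) : l \in B ->
    g l = \sum_(i in B) (i == l)%:R *: g i.
  move=> lB; rewrite (bigD1 l) //= eqxx scale1r big1 ?addr0 // => i /andP[_ il].
  by rewrite (negbTE il) scale0r.
have sep l : exists u, [/\ forall i, i \in A -> 0 <= dot u (g i),
    dot u (g j) = 0 & l \in A -> l != j -> dot u (g l) = 0 -> g l = 0].
  have [lA|lA] := boolP (l \in A); last first.
    by exists 0; split=> //; [move=> i _|]; rewrite dot0l.
  have [->|lj] := eqVneq l j.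
    by exists 0; split=> //; [move=> i _|]; rewrite dot0l.
  have [gl0|gl0] := eqVneq (g l) 0.
    by exists 0; split=> //; [move=> i _|]; rewrite dot0l.
  apply: contrapT => nu_.
  (* Farkas' lemma is applied to [- g l]; adjoining [- g j] to the generators forces a functional
     nonnegative on the family to vanish at [g j]. *)
  pose h (o : option 'I_k) := if o is Some i then g i else - g j.
  have us : uniq (None :: map Some (enum A)).
    have SI : injective (@Some 'I_k) by move=> a b [].
    rewrite /= (map_inj_uniq SI) enum_uniq andbT.
    by apply/negP => /mapP[i _].
  have [|c [c0 cE]] := @farkas _ _ _ _ h (- g l) us.
    move=> u hu; rewrite leNgt; apply/negP => ul; apply: nu_; exists u.
    have uA i : i \in A -> 0 <= dot u (g i).
      by move=> iA; apply: (hu (Some i)); rewrite inE map_f ?mem_enum.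
    split=> //; last by move: ul; rewrite dotNr => /[swap] _ /[swap] _ /[swap] ->; rewrite oppr0 ltxx.
    apply/eqP; rewrite eq_le uA // andbT -oppr_ge0 -dotNr.
    by apply: (hu None); rewrite inE.
  move: cE; rewrite big_cons big_map big_enum /= (bigD1 j) //=.
  pose d i := c (Some i); pose t := c None - d j.
  rewrite (eq_bigl (mem (A :\ j))); last by move=> i; rewrite !inE andbC.
  set y := \sum_(_ in _) _ => cE.
  have tE : - g l = - t *: g j + y.
    by rewrite cE scalerN -scaleNr addrA -scalerDl /t opprB (addrC (d j)).
  have lAj : l \in A :\ j by rewrite !inE lj.
  (* For [t > 0], [g j] becomes a nonnegative combination of the other generators, against [irr];
     for [t <= 0], [- g l] lies in [sigma], against strong convexity. *)
  have [t0|t0] := ltP 0 t.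
    apply: irr; exists (fun i => t^-1 * ((i == l)%:R + d i)); split.
      move=> i; apply: mulr_ge0; first by rewrite invr_ge0 ltW.
      by apply: addr_ge0; rewrite ?ler0n ?c0.
    under eq_bigr => i _ do rewrite -scalerA scalerDl.
    rewrite -scaler_sumr big_split /= -single // -/y -(opprK (g l)) tE.
    by rewrite opprD subrK scaleNr opprK scalerA mulVf ?scale1r // gt_eqF.
  case/negP: gl0; apply/eqP; apply: scs; first exact: sg.
  rewrite tE; apply: coneD => //.
    by apply: coneZ => //; [rewrite oppr_ge0 | exact: sg].
  apply: cone_sum => // i; rewrite !inE => /andP[_ iA].
  by apply: coneZ => //; apply: sg.
have [u uP] := choice sep.
pose U := \sum_l u l.
have Ug i : i \in A -> 0 <= dot U (g i).
  move=> iA; rewrite /U dot_suml sumr_ge0 // => l _.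
  by case: (uP l) => + _ _; apply.
have Ugj : dot U (g j) = 0.
  by rewrite /U dot_suml big1 // => l _; case: (uP l).
have Ug0 l : l \in A -> l != j -> dot U (g l) = 0 -> g l = 0.
  move=> lA lj; rewrite /U dot_suml => /eqP; rewrite psumr_eq0 => [/allP|i _].
    move=> /(_ l (mem_index_enum l)) /eqP h; case: (uP l) => _ _; exact.
  by case: (uP i) => + _ _; apply.
pose tau := [set v | sigma v /\ dot U v = 0].
have Stau : Sigma tau.
  apply: (Sf sigma) => //; exists U; split=> // v; rewrite sE => -[c [c0 ->]].
  rewrite dot_sumr sumr_ge0 // => i iA.
  by rewrite dotZr mulr_ge0 // Ug.
have tauE v : tau v -> exists2 a, 0 <= a & v = a *: g j.
  case; rewrite {1}sE => -[c [c0 ->]]; rewrite dot_sumr => /eqP.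
  rewrite psumr_eq0 => [/allP h|i iA]; last by rewrite dotZr mulr_ge0 // Ug.
  exists (c j) => //; rewrite (bigD1 j) //= big1 ?addr0 // => i /andP[iA ij].
  have := h i (mem_index_enum i); rewrite iA dotZr mulf_eq0 => /orP[/eqP->|/eqP].
    by rewrite scale0r.
  by move/(Ug0 _ iA ij) ->; rewrite scaler0.
have tj : tau (g j) by split=> //; exact: sg.
have tdim : cone_dim tau 1.
  exists (g j); split.
  - by rewrite /row_free rank_rV gj0.
  - by move=> i; rewrite row_id.
  - by move=> v /tauE[a _ ->]; apply: scalemx_sub.
have [i _ ri] : exists2 i, True & rho i = tau.
  by case: edges_rho => _ _ /(_ tau) [] // i _ ri; exists i.
have [_ Li _] := first_nu i; move: (Li); rewrite ri => -[sLi _].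
move: Li; rewrite ri => /tauE[a a0 aE].
have an0 : a != 0 by apply: contraNneq (ray_neq0 i) => z; rewrite aE z scale0r.
by exists i, a^-1; split; rewrite ?invr_ge0 // aE scalerA mulVf // scale1r.
Qed.

(** A generating subset of least cardinality has no redundant element, so by [fan_extremal_ray] each
    of its elements is a nonnegative multiple of some [L i] in [sigma]. *)
Lemma fan_cone_gen sigma x : Sigma sigma -> sigma x ->
  exists c : 'I_r -> R, [/\ forall i, 0 <= c i,
    forall i, c i != 0 -> sigma (L i) & x = \sum_i c i *: L i].
Proof.
move=> Ss; have cs := fan_cone Ss; case: (cs) => k [g sE].
pose gen (A : {set 'I_k}) := sigma = [set v | exists c : 'I_k -> R,
    (forall i, 0 <= c i) /\ v = \sum_(i in A) c i *: latt R (g i)].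
have genT : `[< gen (finset.setTfor 'I_k) >].
  apply/asboolP; rewrite /gen sE; apply/seteqP; split=> v [c [c0 ->]]; exists c.
    by split=> //; apply: eq_bigl => i; rewrite finset.in_setT.
  by split=> //; apply: eq_bigl => i; rewrite finset.in_setT.
have [A /asboolP gA minA] := @arg_minnP _ _ (fun A : {set 'I_k} => `[< gen A >])
  (fun A : {set 'I_k} => #|A|) genT.
have ray j : j \in A ->
    exists i t, [/\ 0 <= t, sigma (L i) & latt R (g j) = t *: L i].
  move=> jA; apply: (@fan_extremal_ray _ _ (latt R \o g) A) => //= -[d [d0 gj]].
  have : `[< gen (A :\ j) >].
    apply/asboolP; rewrite /gen gA; apply/seteqP; split=> v [c [c0 ->]]; last first.
      exists (fun i => if i == j then 0 else c i); split; first by move=> i; case: ifP.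
      rewrite [RHS](bigD1 j) //= eqxx scale0r add0r.
      apply: eq_big => [i|i]; first by rewrite !inE andbC.
      by rewrite !inE => /andP[/negbTE->].
    exists (fun i => c i + c j * d i); split.
      by move=> i; rewrite addr_ge0 ?mulr_ge0.
    rewrite [RHS](eq_bigr (fun i => c i *: latt R (g i) +
      c j *: (d i *: latt R (g i)))); last by move=> i _; rewrite scalerDl scalerA.
    rewrite big_split /= -scaler_sumr -gj (bigD1 j) //= addrC; congr (_ + _).
    by apply: eq_bigl => i; rewrite !inE andbC.
  by move/minA; rewrite (cardsD1 j A) jA ltnn.
pose Q v := exists c : 'I_r -> R, [/\ forall i, 0 <= c i,
    forall i, c i != 0 -> sigma (L i) & v = \sum_i c i *: L i].
rewrite -/(Q x) gA => -[c [c0 ->]]; apply: (big_ind Q).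
- exists (fun=> 0); split=> // [i|]; first by rewrite eqxx.
  by rewrite big1 // => i _; rewrite scale0r.
- move=> v w [a [a0 aL ->]] [b [b0 bL ->]]; exists (fun i => a i + b i); split.
  + by move=> i; apply: addr_ge0.
  + move=> i; have [az|/aL //] := eqVneq (a i) 0.
    by rewrite az add0r => /bL.
  + by rewrite -big_split; apply: eq_bigr => i _; rewrite scalerDl.
- move=> j /ray[i [t [t0 sLi ->]]]; exists (fun l => if l == i then c j * t else 0).
  split.
  + by move=> l; case: ifP => // _; apply: mulr_ge0.
  + by move=> l; case: (l =P i) => [->//|_]; rewrite eqxx.
  + rewrite (bigD1 i) //= eqxx scalerA big1 ?addr0 // => l /negbTE ->.
    by rewrite scale0r.
Qed.

(** Coordinates in the basis of [sigma] are linear because they are unique; hence each is the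
    pairing with an integer vector [D i]. *)
Lemma fan_dual_basis sigma : Sigma sigma -> cone_dim sigma n ->
  exists D : 'I_r -> 'rV[int]_n,
    (forall m : 'rV[int]_n, m = \sum_(i | `[< sigma (L i) >]) dot (D i) m *: nu i) /\
    (forall i j, sigma (L i) -> sigma (L j) -> dot (D j) (nu i) = (i == j)%:R).
Proof.
move=> Ss sd; have hZ := smooth_Sigma Ss sd.
have [kap kapP] := choice hZ.
have kapD m (c : 'rV[int]_r) : (forall i, ~ sigma (L i) -> c 0 i = 0) ->
    m = \sum_i c 0 i *: nu i -> c = kap m.
  by move=> c0 mE; have [_ h] := kapP m; rewrite (h c).
have kapS m i : ~ sigma (L i) -> kap m 0 i = 0.
  by move=> h; have [[h0 _] _] := kapP m; apply: h0.
have kapE m : m = \sum_i kap m 0 i *: nu i by have [[_ h] _] := kapP m.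
pose D i : 'rV[int]_n := \row_j kap (delta_mx 0 j) 0 i.
have DE m i : dot (D i) m = kap m 0 i.
  have -> : kap m = \sum_j m 0 j *: kap (delta_mx 0 j).
    symmetry; apply: kapD => [l nl|].
      by rewrite summxE big1 // => j _; rewrite mxE kapS ?mulr0.
    under eq_bigr => l _ do rewrite summxE scaler_suml.
    rewrite exchange_big /= {1}(row_sum_delta m); apply: eq_bigr => j _.
    rewrite [in LHS](kapE (delta_mx 0 j)) scaler_sumr; apply: eq_bigr => l _.
    by rewrite scalerA mxE.
  by rewrite summxE; apply: eq_bigr => j _; rewrite !mxE mulrC.
exists D; split.
  move=> m; rewrite {1}(kapE m) [RHS]big_mkcond; apply: eq_bigr => i _.
  by rewrite DE; case: asboolP => // h; rewrite kapS // scale0r.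
move=> i j si sj; rewrite DE -(kapD (nu i) (delta_mx 0 i)).
- by rewrite mxE eqxx eq_sym.
- by move=> l nl; rewrite mxE eqxx /=; case: eqP => // li; rewrite -li in si.
- rewrite (bigD1 i) //= mxE !eqxx scale1r big1 ?addr0 // => l li.
  by rewrite mxE eqxx (negbTE li) scale0r.
Qed.

(** * Decomposition of lattice vectors along the cones of the fan *)

Definition in_common_cone (S : {set 'I_r}) : Prop :=
  exists2 sigma, Sigma sigma & forall i, i \in S -> sigma (L i).

Lemma in_common_coneS (S T : {set 'I_r}) :
  S \subset T -> in_common_cone T -> in_common_cone S.
Proof.
by move=> /fintype.subsetP ST [s Ss h]; exists s => // i /ST /h.
Qed.

(** Matches the edges in the definition of irreducibility with the generators in the definition of
    [cox_Z]. *)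
Lemma in_common_coneE (S : {set 'I_r}) : in_common_cone S <->
  exists2 sigma, Sigma sigma & forall i, i \in S -> rho i `<=` sigma.
Proof.
split=> -[s Ss h]; exists s => // i iS.
  by apply/(ray_subset _ Ss)/h.
by apply/(ray_subset _ Ss)/h.
Qed.

(** The sum of the [L i] is a positive combination within one cone, so any cone of the fan
    containing it contains every [L i]; the last clause picks such a cone in the direction [v] from
    this sum. *)
Lemma fan_full_cone_of (S : {set 'I_r}) (v : 'rV[R]_n) : in_common_cone S ->
  exists2 sigma, Sigma sigma & [/\ cone_dim sigma n,
    forall i, i \in S -> sigma (L i) &
    exists N : nat, sigma (N%:R *: \sum_(i in S) L i + v)].
Proof.
move=> [tau St tS].
have [sigma Ss [sd sS sv]] := fan_full_cover_dir (\sum_(i in S) L i) v.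
exists sigma => //; split=> //.
apply: (@fan_face_sum tau sigma _ S (fun i => L i) (fun=> 1)) => //.
  by move=> i /tS ti; rewrite ltr01.
by under eq_bigr => i _ do rewrite scale1r.
Qed.

(** The coefficients are the coordinates of [v] in a full-dimensional cone that contains [S] and
    also [v] plus a multiple of the sum over [S]. That multiple changes only coordinates in [S], so
    the others are nonnegative. *)
Lemma fan_decomposition (S : {set 'I_r}) (v : 'rV[int]_n) : in_common_cone S ->
  exists c : 'I_r -> int, [/\ v = \sum_i c i *: nu i,
    forall i, i \notin S -> 0 <= c i &
    in_common_cone (S :|: [set i | c i != 0])%SET].
Proof.
move=> /(fan_full_cone_of (latt R v)) [sigma Ss [sd sS [N sN]]].
have [D [DE Dd]] := fan_dual_basis Ss sd.
exists (fun i => if `[< sigma (L i) >] then dot (D i) v else 0); split.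
- rewrite {1}(DE v) big_mkcond; apply: eq_bigr => i _.
  by case: ifP => // _; rewrite scale0r.
- move=> i iS; case: asboolP => // si.
  have [c [c0 cs cE]] := fan_cone_gen Ss sN.
  have := congr1 (dot (latt R (D i))) cE.
  rewrite dotDr dotZr !dot_sumr dot_latt big1 => [|j jS]; last first.
    rewrite dot_latt (Dd _ _ (sS j jS) si) (_ : (j == i) = false) //.
    by apply: contraNF iS => /eqP <-.
  rewrite mulr0 add0r (bigD1 i) //= big1 => [|j ji]; last first.
    have [->|/cs sj] := eqVneq (c j) 0; first by rewrite scale0r dot0r.
    by rewrite dotZr dot_latt Dd // (negbTE ji) mulr0.
  by rewrite addr0 dotZr dot_latt Dd // eqxx mulr1 => e; rewrite -(ler0z R) e.
- exists sigma => // i; rewrite !inE => /orP[/sS //|].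
  by case: asboolP => //; rewrite eqxx.
Qed.

(** Adding a large multiple of the generators in [S] gives two positive combinations for the same
    vector. By [fan_face_sum] the generators of the first lie in the cone of the second, and in a
    common smooth cone a dual basis reads off the coefficients. *)
Lemma fan_decomposition_uniq (S : {set 'I_r}) (a b : 'I_r -> int) :
  (forall i, i \notin S -> 0 <= a i) -> (forall i, i \notin S -> 0 <= b i) ->
  in_common_cone (S :|: [set i | a i != 0])%SET ->
  in_common_cone (S :|: [set i | b i != 0])%SET ->
  \sum_i a i *: nu i = \sum_i b i *: nu i -> a =1 b.
Proof.
move=> a0 b0 [sa Ssa ha] [sb Ssb hb] ab.
(* The summand [1] makes [N] strictly larger than all [|a i|] and [|b i|], so coefficients shifted
   by [N] on [S] are positive. *)
pose N : int := 1 + \sum_i (`|a i| + `|b i|).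
have posN (c : 'I_r -> int) (i : 'I_r) : (forall i, i \notin S -> 0 <= c i) ->
    `|c i| < N -> i \in (S :|: [set i | c i != 0])%SET ->
    0 < c i + (if i \in S then N else 0).
  move=> c0 cN; rewrite !inE; case: ifP => [iS _|iS /= ci].
    by move: cN; rewrite ltr_norml => /andP[cN _]; rewrite -[N]opprK subr_gt0.
  by rewrite addr0 lt_def ci c0 // iS.
have boundN i : `|a i| < N /\ `|b i| < N.
  have h : `|a i| + `|b i| <= \sum_i (`|a i| + `|b i|).
    by rewrite [leRHS](bigD1 i) //= lerDl sumr_ge0 // => j _; apply: addr_ge0.
  have [an bn] : 0 <= `|a i| /\ 0 <= `|b i| by split.
  by rewrite /N; split; lia.
have shift (c : 'I_r -> int) (A := (S :|: [set i | c i != 0])%SET) :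
    \sum_(i in A) (c i + (if i \in S then N else 0))%:~R *: L i =
    \sum_i (c i)%:~R *: L i + \sum_(i in S) N%:~R *: L i.
  rewrite [X in _ + X]big_mkcond -big_split big_mkcond /=; apply: eq_bigr => i _.
  rewrite !inE; case: (i \in S) => /=; first by rewrite intrD scalerDl.
  by rewrite !addr0; case: eqP => //= ->; rewrite scale0r.
have sumL (c : 'I_r -> int) : \sum_i (c i)%:~R *: L i = latt R (\sum_i c i *: nu i).
  by rewrite latt_sum; apply: eq_bigr => i _; rewrite lattZ.
have sub i : i \in (S :|: [set i | a i != 0])%SET -> sb (L i).
  apply: (@fan_face_sum sa sb _ _ (fun i => L i)
      (fun i => (a i + (if i \in S then N else 0))%:~R)) => //.
    by move=> j jA; rewrite ltr0z; split; [exact: ha|apply: posN => //; case: (boundN j)].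
  rewrite shift sumL ab -sumL -shift; apply: cone_sum; first exact: fan_cone.
  move=> j jB; apply: coneZ; [exact: fan_cone| |exact: hb].
  by rewrite ler0z ltW //; apply: posN => //; case: (boundN j).
have [|w Sw [wd wS _]] := @fan_full_cone_of
    (S :|: [set i | a i != 0] :|: [set i | b i != 0])%SET 0.
  exists sb => // i; rewrite inE => /orP[/sub //|ib].
  by apply: hb; rewrite inE ib orbT.
have [D [_ Dd]] := fan_dual_basis Sw wd.
have coord (c : 'I_r -> int) i : w (L i) -> (forall j, c j != 0 -> w (L j)) ->
    dot (D i) (\sum_j c j *: nu j) = c i.
  move=> wi hc; rewrite dot_sumr (bigD1 i) //= dotZr Dd // eqxx mulr1.
  rewrite big1 ?addr0 // => j ji; have [->|/hc wj] := eqVneq (c j) 0.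
    by rewrite scale0r dot0r.
  by rewrite dotZr Dd // (negbTE ji) mulr0.
have wa j : a j != 0 -> w (L j) by move=> h; apply: wS; rewrite !inE h orbT.
have wb j : b j != 0 -> w (L j) by move=> h; apply: wS; rewrite !inE h orbT.
move=> i; have [ai|ai] := eqVneq (a i) 0; last first.
  by have wi := wa i ai; rewrite -(coord a i) // ab coord.
have [bi|bi] := eqVneq (b i) 0; first by rewrite ai bi.
by have wi := wb i bi; rewrite -(coord a i) // ab coord.
Qed.

(* Pairing with the [m] orthogonal to [S] determines a vector modulo the span of
   the [nu i], [i \in S]. *)
Lemma fan_decomposition_uniq_mod (S : {set 'I_r}) (a b : 'I_r -> int) :
  (forall i, i \notin S -> 0 <= a i) -> (forall i, i \notin S -> 0 <= b i) ->
  in_common_cone (S :|: [set i | a i != 0])%SET ->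
  in_common_cone (S :|: [set i | b i != 0])%SET ->
  (forall m : 'rV[int]_n, (forall i, i \in S -> dot m (nu i) = 0) ->
    \sum_(i | i \notin S) a i * dot m (nu i) =
    \sum_(i | i \notin S) b i * dot m (nu i)) ->
  forall i, i \notin S -> a i = b i.
Proof.
move=> a0 b0 ca cb hm i iS.
have cS : in_common_cone S.
  by apply: in_common_coneS ca; apply: finset.subsetUl.
have [w Sw [wd wS _]] := fan_full_cone_of 0 cS.
have [D [DE Dd]] := fan_dual_basis Sw wd.
pose v := \sum_(i | i \notin S) (a i - b i) *: nu i.
(* For [j] outside [S], [D j] is orthogonal to the generators in [S], so [hm] kills that coordinate
   of [v]. *)
have vE : v = \sum_(j in S) dot (D j) v *: nu j.
  rewrite {1}(DE v) (bigID (mem S)) /= [X in _ + X]big1 ?addr0.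
    apply: eq_bigl => j; rewrite andbC; case: (boolP (j \in S)) => //= jS.
    by apply/asboolP/wS.
  move=> j /andP[/asboolP wj jS].
  have /hm e : forall l, l \in S -> dot (D j) (nu l) = 0.
    move=> l lS; rewrite (Dd _ _ (wS l lS) wj); case: eqP => // lj.
    by rewrite -lj lS in jS.
  rewrite /v dot_sumr (_ : \sum_(_ | _) _ = 0) ?scale0r //.
  under eq_bigr => l _ do rewrite dotZr mulrBl.
  by rewrite sumrB e subrr.
(* [v] is moved into the coefficients of [b'] on [S], where signs are free, so that the two sums
   agree. *)
pose a' j := if j \in S then 0 else a j.
pose b' j := if j \in S then dot (D j) v else b j.
have : a' =1 b'.
  apply: (@fan_decomposition_uniq S).
  - by move=> j jS; rewrite /a' (negbTE jS) a0.
  - by move=> j jS; rewrite /b' (negbTE jS) b0.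
  - apply: in_common_coneS ca; apply/fintype.subsetP => j; rewrite !inE /a'.
    by case: (j \in S).
  - apply: in_common_coneS cb; apply/fintype.subsetP => j; rewrite !inE /b'.
    by case: (j \in S).
  rewrite (bigID (mem S)) [RHS](bigID (mem S)) /=.
  rewrite big1 => [|j jS]; last by rewrite /a' jS scale0r.
  rewrite (eq_bigr (fun j => a j *: nu j)) => [|j jS]; last by rewrite /a' (negbTE jS).
  rewrite [X in _ = X + _](eq_bigr (fun j => dot (D j) v *: nu j)) => [|j jS]; last by rewrite /b' jS.
  rewrite [X in _ = _ + X](eq_bigr (fun j => b j *: nu j)) => [|j jS]; last first.
    by rewrite /b' (negbTE jS).
  rewrite -vE add0r /v -big_split /=; apply: eq_bigr => j _.
  by rewrite scalerBl subrK.
by move=> /(_ i); rewrite /a' /b' (negbTE iS).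
Qed.

End Fan.

(** * Rational maps on affine space *)

Section Eval.
Variable K : fieldType.

Lemma meval_mwiden n (v : 'I_n.+1 -> K) (c : {mpoly K[n]}) :
  (mwiden c).@[v] = c.@[fun i => v (widen_ord (leqnSn n) i)].
Proof.
elim/mpolyind: c => [|a m p _ _ IH]; first by rewrite mwiden0 !meval0.
rewrite mwidenD !mevalD IH; congr (_ + _).
rewrite mwidenZ mwidenX !mevalZ !mevalX big_ord_recr /= mnmwiden_ordmax.
by rewrite expr0 mulr1; congr (_ * _); apply: eq_bigr => i _; rewrite mnmwiden_widen.
Qed.

Lemma meval_un_muni n (v : 'I_n.+1 -> K) (q : {poly {mpoly K[n]}}) :
  (un_muni q).@[v] =
  (map_poly (meval (fun i => v (widen_ord (leqnSn n) i))) q).[v ord_max].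
Proof.
elim/poly_ind: q => [|q c IH].
  by rewrite /un_muni !rmorph0 !horner0 meval0.
rewrite un_muniD un_muniM mevalD mevalM IH !rmorphD !rmorphM /=.
rewrite hornerD hornerM map_polyX map_polyC /= hornerX hornerC.
congr (_ * _ + _).
  by rewrite /un_muni map_polyX hornerX mevalXU.
by rewrite /un_muni map_polyC hornerC meval_mwiden.
Qed.

(** The first [n] variables are fixed so that the leading coefficient in the last one stays nonzero;
    the univariate polynomial left has finitely many roots. *)
Lemma mpoly_nonroot n (p : {mpoly K[n]}) : injective (fun k : nat => k%:R : K) ->
  p != 0 -> exists v, p.@[v] != 0.
Proof.
move=> charK; elim: n p => [|n IH] p p0.
  exists (fun=> 0); move: p0; rewrite (nvar0_mpolyC p) mpolyC_eq0.
  by rewrite mevalC.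
have q0 : muni p != 0.
  by apply: contraNneq p0 => e; rewrite -(muniK p) e /un_muni rmorph0 horner0.
have /IH [v pv] : lead_coef (muni p) != 0 by rewrite lead_coef_eq0.
set q := map_poly (meval v) (muni p).
have qn0 : q != 0.
  apply/eqP => /(congr1 (fun g : {poly K} => g`_(size (muni p)).-1)).
  by rewrite coef_map coef0; apply/eqP.
have [k kP] : exists k : nat, ~~ root q k%:R.
  apply: contrapT => h; move/eqP: qn0; apply.
  apply: (@poly_frequent_root _ q (fun k => k%:R) charK) => M; exists M => //.
  by apply/negPn/negP => rM; apply: h; exists M.
exists (fun i => if unlift ord_max i is Some j then v j else k%:R).
rewrite -(muniK p) meval_un_muni unlift_none.
have -> : (fun i : 'I_n => if unlift ord_max (widen_ord (leqnSn n) i) is Some j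
    then v j else k%:R) = v.
  apply/funext => i; rewrite (_ : widen_ord _ _ = lift ord_max i) ?liftK //.
  by apply/val_inj; rewrite /= /bump leqNgt ltn_ord.
exact: kP.
Qed.

End Eval.

(** * The Zariski topology of affine space *)

Section Zariski.
Variables (R : realType).
Local Notation C := R[i].

Lemma mpoly_nonzero_point d (p : {mpoly C[d]}) : p != 0 -> exists v, p.@[v] != 0.
Proof.
by apply: mpoly_nonroot => a b /eqP; rewrite eqr_nat => /eqP.
Qed.

(** Density of a basic open set: otherwise [s * (p - q)] would be a nonzero polynomial vanishing
    everywhere. *)
Lemma mpoly_eq_on d (s p q : {mpoly C[d]}) : s != 0 ->
  (forall y, s.@[y] != 0 -> p.@[y] = q.@[y]) -> p = q.
Proof.
move=> s0 h; apply/eqP; rewrite -subr_eq0; apply/negPn/negP => pq.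
have [v] := mpoly_nonzero_point (mulf_neq0 s0 pq).
by rewrite mevalM mulf_eq0 negb_or mevalB => /andP[/h ->]; rewrite subrr eqxx.
Qed.

Lemma zariski_open_basic d (s : {mpoly C[d]}) :
  zariski_open [set y | s.@[y] != 0].
Proof.
exists [set s]; apply/seteqP; split=> y /=; first by move=> h; exists s.
by case=> _ ->.
Qed.

Lemma zariski_open_nbhd d (U : set (cpt R d)) y : zariski_open U -> U y ->
  exists2 s : {mpoly C[d]}, s.@[y] != 0 & [set y | s.@[y] != 0] `<=` U.
Proof.
by case=> S -> [s Ss sy]; exists s => // z /= sz; exists s.
Qed.

Lemma zariski_openI d (U V : set (cpt R d)) :
  zariski_open U -> zariski_open V -> zariski_open (U `&` V).
Proof.
case=> S -> [T ->]; exists [set p | exists s t, [/\ S s, T t & p = s * t]].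
apply/seteqP; split=> y /=.
  case=> -[s Ss sy] [t Tt ty]; exists (s * t); first by exists s, t.
  by rewrite mevalM mulf_neq0.
case=> _ [s [t [Ss Tt ->]]]; rewrite mevalM mulf_eq0 negb_or => /andP[sy ty].
by split; [exists s | exists t].
Qed.

(** Irreducibility of affine space, which makes agreement on a nonempty open set transitive. *)
Lemma zariski_openI_neq0 d (U V : set (cpt R d)) :
  zariski_open U -> zariski_open V -> U !=set0 -> V !=set0 -> U `&` V !=set0.
Proof.
move=> oU oV [x Ux] [y Vy].
have [s sx sU] := zariski_open_nbhd oU Ux; have [t ty tV] := zariski_open_nbhd oV Vy.
have s0 : s != 0 by apply: contraNneq sx => ->; rewrite meval0.
have t0 : t != 0 by apply: contraNneq ty => ->; rewrite meval0.
have [z] := mpoly_nonzero_point (mulf_neq0 s0 t0).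
by rewrite mevalM mulf_eq0 negb_or => /andP[sz tz]; exists z; split; [exact: sU|exact: tV].
Qed.

Variables (d r : nat) (F : 'I_r -> {mpoly C[d]}).

Definition pullback (p : {mpoly C[r]}) : {mpoly C[d]} :=
  p \mPo [tuple F i | i < r].

Lemma meval_pullback p y : (pullback p).@[y] = p.@[poly_map F y].
Proof.
by rewrite comp_mpoly_meval; apply: meval_eq => i; rewrite tnth_mktuple.
Qed.

Lemma zariski_open_preimage (U : set (cpt R r)) :
  zariski_open U -> zariski_open (poly_map F @^-1` U).
Proof.
case=> S ->; exists (pullback @` S); apply/seteqP; split=> y /=.
  by case=> p Sp py; exists (pullback p); [exists p | rewrite meval_pullback].
by case=> _ [p Sp <-]; rewrite meval_pullback; exists p.
Qed.

Lemma zariski_regular_preimage (U : set (cpt R r)) (h : cpt R r -> C) :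
  zariski_regular U h -> zariski_regular (poly_map F @^-1` U) (h \o poly_map F).
Proof.
move=> hU y /hU [V [p [q [oV Vy VU hV]]]].
exists (poly_map F @^-1` V), (pullback p), (pullback q); split=> //.
- exact: zariski_open_preimage.
- by move=> z /VU.
- by move=> z /hV; rewrite !meval_pullback.
Qed.

End Zariski.

(** * Equality of rational maps *)

Section RationalMaps.
Variables (R : realType) (d : nat) (T : Type) (Y : funspace R T).
Local Notation X := (affine_space R d).

Lemma rat_equiv_sym (phi psi : Defs.pmap (cpt R d) T) :
  rat_equiv X phi psi -> rat_equiv X psi phi.
Proof.
case=> W [oW W0 WU WE]; exists W; split=> //; first by move=> x /WU[].
by move=> x /WE.
Qed.

Lemma rat_equiv_trans (phi psi chi : Defs.pmap (cpt R d) T) :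
  rat_equiv X phi psi -> rat_equiv X psi chi -> rat_equiv X phi chi.
Proof.
case=> W [oW W0 WU WE] [W' [oW' W'0 WU' WE']]; exists (W `&` W'); split.
- exact: zariski_openI.
- exact: zariski_openI_neq0.
- by move=> x [/WU[? _] /WU'[]].
- by move=> x [/WE -> /WE'].
Qed.

Lemma rat_equiv_refl (phi : Defs.pmap (cpt R d) T) :
  rat_rep X Y phi -> rat_equiv X phi phi.
Proof. by case=> oU U0 _; exists phi.1; split. Qed.

Lemma rat_class_eqP (phi psi : Defs.pmap (cpt R d) T) : rat_rep X Y psi ->
  (rat_class X Y phi = rat_class X Y psi <-> rat_equiv X phi psi).
Proof.
move=> hpsi; split=> [e|e].
  have : rat_class X Y psi psi by split=> //; apply: rat_equiv_refl.
  by rewrite -e => -[].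
apply/seteqP; split=> chi [hchi echi]; split=> //.
  by apply: rat_equiv_trans echi; apply: rat_equiv_sym.
exact: rat_equiv_trans e echi.
Qed.

End RationalMaps.

(** * Cox coordinates *)

Section CoxGroup.
Variables (R : realType) (n r : nat) (nu : 'I_r -> 'rV[int]_n).
Local Notation C := R[i].
Local Notation G := (cox_group R nu).

Lemma prodr_exprz (F : fieldType) (I : Type) (s : seq I) (P : pred I)
    (f : I -> F) (k : int) :
  (\prod_(i <- s | P i) f i) ^ k = \prod_(i <- s | P i) f i ^ k.
Proof.
apply: (big_morph (fun x : F => x ^ k)) => [x y|]; first exact: expfzMl.
exact: exp1rz.
Qed.

Lemma expfz_sum (F : fieldType) (I : Type) (s : seq I) (P : pred I)
    (f : I -> int) (x : F) : x != 0 ->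
  x ^ (\sum_(i <- s | P i) f i) = \prod_(i <- s | P i) x ^ f i.
Proof.
move=> x0; apply: (big_morph (fun k : int => x ^ k)) => [a b|].
  exact: expfzDr.
exact: expr0z.
Qed.

Lemma cox_group1 : G (fun=> 1).
Proof.
by split=> [i|m]; [exact: oner_neq0|rewrite big1 // => i _; rewrite exp1rz].
Qed.

Lemma cox_groupM mu mu' : G mu -> G mu' -> G (fun i => mu i * mu' i).
Proof.
move=> [m0 m1] [m'0 m'1]; split=> [i|m]; first exact: mulf_neq0.
under eq_bigr => i _ do rewrite expfzMl.
by rewrite big_split /= m1 m'1 mulr1.
Qed.

Lemma cox_groupV mu : G mu -> G (fun i => (mu i)^-1).
Proof.
move=> [m0 m1]; split=> [i|m]; first by rewrite invr_eq0.
under eq_bigr => i _ do rewrite exprz_inv -invr_expz.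
by rewrite prodfV m1 invr1.
Qed.

Lemma cox_orbit_refl (x : cpt R r) : cox_orbit nu x x.
Proof.
by exists (fun=> 1); [exact: cox_group1|apply/funext => i; rewrite mul1r].
Qed.

Lemma cox_orbit_mul mu (x : cpt R r) :
  G mu -> cox_orbit nu (fun i => mu i * x i) = cox_orbit nu x.
Proof.
move=> Gmu; apply/seteqP; split=> y [mu' Gmu' ->].
  exists (fun i => mu' i * mu i); first exact: cox_groupM.
  by apply/funext => i; rewrite mulrA.
exists (fun i => mu' i * (mu i)^-1); first exact/cox_groupM/cox_groupV.
by apply/funext => i; rewrite -mulrA mulKf //; case: Gmu.
Qed.

Lemma g_equivalent_refl d (F : 'I_r -> {mpoly C[d]}) : g_equivalent nu F F.
Proof.
by exists (fun=> 1); [exact: cox_group1|apply/funext => i; rewrite scale1r].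
Qed.

Lemma g_class_eq d (F F' : 'I_r -> {mpoly C[d]}) :
  g_equivalent nu F F' -> g_class nu F = g_class nu F'.
Proof.
case=> mu Gmu ->; apply/seteqP; split=> H [mu' Gmu' ->].
  exists (fun i => mu' i * (mu i)^-1); first exact/cox_groupM/cox_groupV.
  apply/funext => i; rewrite scalerA -mulrA mulVf ?mulr1 //.
  by case: Gmu.
exists (fun i => mu' i * mu i); first exact: cox_groupM.
by apply/funext => i; rewrite scalerA.
Qed.

Variable Sigma : set (set 'rV[R]_n).

Lemma cox_ZNP (x : cpt R r) :
  (~` cox_Z Sigma nu) x <-> in_common_cone Sigma nu [set i | x i == 0]%SET.
Proof.
split=> [nZ|[s Ss hs]].
  apply: contrapT => nc; apply: nZ => s Ss; apply/eqP/negPn/negP => xs.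
  apply: nc; exists s => // i; rewrite inE => /eqP xi.
  apply: contrapT => nsi; move: xs; rewrite /xhat (bigD1 i) /= ?xi ?mul0r ?eqxx //.
  by apply/negP; rewrite in_setE.
move=> /(_ s Ss) /eqP; apply/negP/prodf_neq0 => i nsi.
apply: contraNneq nsi => xi; rewrite in_setE; apply: hs.
by rewrite inE xi.
Qed.

Lemma cox_Z_mul mu (x : cpt R r) : G mu ->
  (~` cox_Z Sigma nu) (fun i => mu i * x i) <-> (~` cox_Z Sigma nu) x.
Proof.
move=> [mu0 _]; rewrite !cox_ZNP.
rewrite (_ : [set i | mu i * x i == 0]%SET = [set i | x i == 0]%SET) //.
by apply/setP => i; rewrite !inE mulf_eq0 (negbTE (mu0 i)).
Qed.

Lemma cox_Z_orbit (x y : cpt R r) : cox_orbit nu x = cox_orbit nu y ->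
  (~` cox_Z Sigma nu) x <-> (~` cox_Z Sigma nu) y.
Proof.
move=> e; have [mu Gmu ->] : cox_orbit nu y x by rewrite -e; apply: cox_orbit_refl.
exact: cox_Z_mul.
Qed.

Lemma cox_Z_open : zariski_open (~` cox_Z Sigma nu : set (cpt R r)).
Proof.
exists [set p | exists2 s, Sigma s & p = \prod_(i | latt R (nu i) \notin s) 'X_i].
have ev s (x : cpt R r) :
    (\prod_(i | latt R (nu i) \notin s) 'X_i).@[x] = xhat nu s x.
  by rewrite rmorph_prod /=; apply: eq_bigr => i _; rewrite mevalXU.
apply/seteqP; split=> x /=.
  move=> nZ; apply: contrapT => h; apply: nZ => s Ss.
  apply/eqP/negPn/negP => xs; apply: h.
  by exists (\prod_(i | latt R (nu i) \notin s) 'X_i); [exists s|rewrite ev].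
by case=> _ [s Ss ->]; rewrite ev => xs /(_ s Ss) /eqP; apply/negP.
Qed.

Variable d : nat.
Implicit Types F : 'I_r -> {mpoly C[d]}.

Lemma pi_comp_morphism F :
  morphism_on (affine_space R d) (toric_variety Sigma nu)
    (pi_comp Sigma nu F).1 (pi_comp Sigma nu F).2.
Proof.
split=> [x Ux|V [_ oV]|V h [_ oV] hV].
- by exists (poly_map F x).
- exact: (zariski_open_preimage F oV).
- exact: (@zariski_regular_preimage R d r F
    (~` cox_Z Sigma nu `&` cox_orbit nu @^-1` V) (h \o cox_orbit nu) hV).
Qed.

(** At a point where no nonzero [F i] vanishes, the zero coordinates are those with [F i = 0], so
    the domain is nonempty. *)
Lemma pi_comp_rat_rep F : in_common_cone Sigma nu [set i | F i == 0]%SET ->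
  rat_rep (affine_space R d) (toric_variety Sigma nu) (pi_comp Sigma nu F).
Proof.
move=> cF; split; [exact/zariski_open_preimage/cox_Z_open| |exact: pi_comp_morphism].
have [|y Py] := @mpoly_nonzero_point R d (\prod_(i | F i != 0) F i).
  by apply/prodf_neq0.
exists y; apply/cox_ZNP; apply: in_common_coneS cF.
apply/fintype.subsetP => i; rewrite !inE; apply: contraTT => Fi.
apply: contraNneq Py => Fiy; rewrite (bigD1 i) //= mevalM.
by rewrite [(F i).@[y]]Fiy mul0r.
Qed.

Lemma pi_comp_g_equivalent F F' :
  g_equivalent nu F F' -> pi_comp Sigma nu F = pi_comp Sigma nu F'.
Proof.
case=> mu Gmu ->.
have e y : poly_map (fun i => mu i *: F i) y = fun i => mu i * poly_map F y i.
  by apply/funext => i; rewrite /poly_map mevalZ.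
congr (_, _); last by apply/funext => y /=; rewrite e cox_orbit_mul.
apply/seteqP; split=> y; rewrite /preimage /= e => h.
  by apply/(@cox_Z_mul mu).
by apply/(@cox_Z_mul mu (poly_map F y)).
Qed.

End CoxGroup.

(** * Orders along a fixed list of primes *)

Section PrimeMonomials.
Variables (K : fieldType) (n : nat) (P : seq {mpoly K[n]}).

Definition factored_as (f : {mpoly K[n]}) (e : {mpoly K[n]} -> nat) : Prop :=
  exists2 c : K, c != 0 & f = c *: \prod_(p <- P) p ^+ e p.

Lemma factored_as1 : factored_as 1 (fun=> 0%N).
Proof. by exists 1; rewrite ?oner_neq0 // scale1r big1. Qed.

Lemma factored_asM f g a b : factored_as f a -> factored_as g b ->
  factored_as (f * g) (fun p => a p + b p)%N.
Proof.
move=> [c c0 ->] [d d0 ->]; exists (c * d); first exact: mulf_neq0.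
rewrite -scalerAl -scalerAr scalerA -big_split; congr (_ *: _).
by apply: eq_bigr => p _; rewrite exprD.
Qed.

Lemma factored_asX f a k : factored_as f a ->
  factored_as (f ^+ k) (fun p => a p * k)%N.
Proof.
move=> [c c0 ->]; exists (c ^+ k); first exact: expf_neq0.
rewrite exprZn -prodrXl; congr (_ *: _).
by apply: eq_bigr => p _; rewrite exprM.
Qed.

Lemma factored_as_prod (I : Type) (s : seq I) (Q : pred I) f a :
  (forall i, Q i -> factored_as (f i) (a i)) ->
  factored_as (\prod_(i <- s | Q i) f i) (fun p => \sum_(i <- s | Q i) a i p)%N.
Proof.
move=> h; elim: s => [|i s IH].
  rewrite big_nil (_ : (fun _ => _) = fun=> 0%N); first exact: factored_as1.
  by apply/funext => p; rewrite big_nil.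
rewrite big_cons; case: ifP => Qi.
  rewrite (_ : (fun _ => _) = fun p => (a i p + \sum_(i <- s | Q i) a i p)%N).
    by apply: factored_asM IH; apply: h.
  by apply/funext => p; rewrite big_cons Qi.
rewrite (_ : (fun _ => _) = fun p => (\sum_(i <- s | Q i) a i p)%N) //.
by apply/funext => p; rewrite big_cons Qi.
Qed.

Lemma factored_as_uniq f a b : uniq P ->
  (forall p, p \in P -> monic_irreducible p) ->
  factored_as f a -> factored_as f b -> {in P, a =1 b}.
Proof. by move=> uP mP [c c0 ->] [d d0] e; apply: exponent_uniq e. Qed.

End PrimeMonomials.

(** * Laurent monomials with denominators cleared *)

Definition posz_part (k : int) : nat := if k is Posz m then m else 0%N.
Definition negz_part (k : int) : nat := if k is Negz m then m.+1 else 0%N.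

Lemma posz_partB k : k = (posz_part k)%:Z - (negz_part k)%:Z.
Proof. by case: k => m /=; rewrite ?subr0 // NegzE sub0r. Qed.

Lemma exprz_parts (F : fieldType) (x : F) k : x != 0 ->
  x ^ k * x ^+ negz_part k = x ^+ posz_part k.
Proof.
move=> x0; case: k => m /=; first by rewrite expr0 mulr1.
by rewrite NegzE -exprnN mulVf // expf_neq0.
Qed.

Lemma meval_prod (K : fieldType) (n : nat) (I : Type) (s : seq I) (Q : pred I)
    (f : I -> {mpoly K[n]}) (y : 'I_n -> K) :
  (\prod_(i <- s | Q i) f i).@[y] = \prod_(i <- s | Q i) (f i).@[y].
Proof. exact: rmorph_prod. Qed.

Lemma meval_exp (K : fieldType) (n : nat) (f : {mpoly K[n]}) (y : 'I_n -> K) k :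
  (f ^+ k).@[y] = f.@[y] ^+ k.
Proof. exact: rmorphXn. Qed.

(** A Laurent monomial equal to [1] at [mu] does not distinguish [f] from [g]; splitting [k] into
    its two parts states this as an equality of values of polynomials. *)
Lemma meval_monomial_ratio (K : fieldType) (n : nat) (I : finType) (Q : pred I)
    (f g : I -> {mpoly K[n]}) (y : 'I_n -> K) (mu : I -> K) (k : I -> int) :
  (forall l, Q l -> mu l != 0) -> (forall l, Q l -> (g l).@[y] = mu l * (f l).@[y]) ->
  \prod_(l | Q l) mu l ^ k l = 1 ->
  (\prod_(l | Q l) (g l ^+ posz_part (k l) * f l ^+ negz_part (k l))).@[y] =
  (\prod_(l | Q l) (f l ^+ posz_part (k l) * g l ^+ negz_part (k l))).@[y].
Proof.
move=> mu0 gE mu1; rewrite !meval_prod -[RHS]mul1r -[X in _ = X * _]mu1.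
rewrite -big_split /=; apply: eq_bigr => l Ql; rewrite !mevalM !meval_exp gE // !exprMn.
rewrite -(exprz_parts (k l) (mu0 l Ql)).
by ring.
Qed.

(** * Lifting rational maps to Cox coordinates *)

Section Lifting.
Variables (R : realType) (n r d : nat) (Sigma : set (set 'rV[R]_n)).
Variables (rho : 'I_r -> set 'rV[R]_n) (nu : 'I_r -> 'rV[int]_n).
Hypotheses (fan_Sigma : is_fan Sigma) (complete_Sigma : complete_fan Sigma)
  (edges_rho : edges_of Sigma rho)
  (first_nu : forall i, first_lattice_vector (rho i) (nu i))
  (smooth_Sigma : smooth_fan Sigma nu).
Local Notation C := R[i].
Local Notation G := (cox_group R nu).
Local Notation irred := (sigma_irreducible Sigma rho).
Local Notation common S := (in_common_cone Sigma nu S).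
Local Notation X := (toric_variety Sigma nu).
Implicit Types F : 'I_r -> {mpoly C[d]}.

Lemma sigma_irreducibleE F : irred F <->
  forall S : {set 'I_r}, ~ common S -> is_gcd F S 1.
Proof.
have E := in_common_coneE fan_Sigma edges_rho first_nu.
by split=> h S nS; apply: h => /E.
Qed.

(** Otherwise zero, a common divisor of the vanishing [F i], would divide their gcd [1]. *)
Lemma sigma_irreducible_zeros F : irred F -> common [set i | F i == 0]%SET.
Proof.
move=> /sigma_irreducibleE h; apply: contrapT => /h[_ /(_ 0)].
case=> [i|g /eqP]; last by rewrite mulr0 oner_eq0.
by rewrite inE => /eqP ->; exists 0; rewrite mul0r.
Qed.

(** Otherwise the nonunit [p] would divide the gcd [1]. Indices with [F i = 0] are included, since
    [p] divides [0]. *)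
Lemma sigma_irreducible_prime F p : irred F -> monic_irreducible p ->
  common [set i | `[< divides p (F i) >]]%SET.
Proof.
move=> /sigma_irreducibleE h [[_ pnu _] _]; apply: contrapT => /h[_ /(_ p)].
case=> [i|g g1]; first by rewrite inE => /asboolP.
by case/negP: pnu; apply/unitrP; exists g; rewrite [p * g]mulrC -g1.
Qed.

Lemma pi_comp_injective F F' : irred F -> irred F' ->
  rat_equiv (affine_space R d) (pi_comp Sigma nu F) (pi_comp Sigma nu F') ->
  g_equivalent nu F F'.
Proof.
move=> iF iF' [W [oW [y0 Wy0] WU WE]].
have [s sy0 sW] := zariski_open_nbhd oW Wy0.
have s0 : s != 0 by apply: contraNneq sy0 => ->; rewrite meval0.
have orb y : s.@[y] != 0 -> exists2 mu, G mu & poly_map F' y = fun i => mu i * poly_map F y i.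
  move=> /sW/WE /= e; suff : cox_orbit nu (poly_map F y) (poly_map F' y) by case=> mu; exists mu.
  by rewrite e; apply: cox_orbit_refl.
have zeros i : (F' i == 0) = (F i == 0).
  apply/eqP/eqP => Fi0; apply: (mpoly_eq_on s0) => y /orb[mu [mu0 _] /(congr1 (@^~ i)) e];
    move: e; rewrite /poly_map /= Fi0 meval0 ?mulr0 // => /esym/eqP.
  by rewrite mulf_eq0 (negbTE (mu0 i)) => /eqP.
pose S := [set i | F i == 0]%SET.
have SF i : i \notin S -> F i != 0 by rewrite inE.
(* Entries vanishing identically are replaced by [1], so that those of [F] ([inl]) and [F'] ([inr])
   factor over one list of primes. *)
pose f (j : 'I_r + 'I_r) := match j with
  | inl i => if i \in S then 1 else F i
  | inr i => if i \in S then 1 else F' i end.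
have f0 j : f j != 0.
  by case: j => i /=; case: ifPn => [_|/SF]; rewrite ?oner_neq0 ?zeros.
have [P [e [c [uP mP c0 fE]]]] := common_factorization f0.
have fac j : factored_as P (f j) (e j) by exists (c j).
(* The orders of [F] and [F'] at [p] decompose the same lattice vector modulo [S], hence agree
   outside [S]. *)
have exps p i : p \in P -> i \notin S -> e (inl i) p = e (inr i) p.
  move=> pP iS.
  pose a j (i : 'I_r) : int := if i \in S then 0 else e (j i) p.
  have conv j (H : 'I_r -> {mpoly C[d]}) : irred H ->
      (forall i, i \in S -> H i = 0) -> (forall i, i \notin S -> f (j i) = H i) ->
      common (S :|: [set i | a j i != 0])%SET.
    move=> iH H0 Hf; apply: in_common_coneS (sigma_irreducible_prime iH (mP p pP)).
    apply/fintype.subsetP => l; rewrite !inE -/S => hl.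
    have [lS|lS] := boolP (l \in S); first by exists 0; rewrite H0 // mul0r.
    move: hl; rewrite /a (negbTE lS) (negbTE (SF l lS)) /=.
    rewrite -Hf // fE (big_rem p pP) /=; case: (e (j l) p) => // k _.
    exists (c (j l) *: (p ^+ k * \prod_(q <- rem p P) q ^+ e (j l) q)).
    by rewrite -scalerAl exprSr mulrAC.
  have := @fan_decomposition_uniq_mod _ _ _ _ _ fan_Sigma complete_Sigma
    smooth_Sigma S (a inl) (a inr) _ _ _ _ _ i iS.
  rewrite /a (negbTE iS) => h; apply/eqP; rewrite -eqz_nat; apply/eqP/h => {h}.
  - by move=> l lS; rewrite (negbTE lS).
  - by move=> l lS; rewrite (negbTE lS).
  - apply: (conv inl F) => // l; first by rewrite inE => /eqP.
    by move=> lS; rewrite /f (negbTE lS).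
  - apply: (conv inr F') => // l; first by rewrite inE -zeros => /eqP.
    by move=> lS; rewrite /f (negbTE lS).
  move=> m mS; pose k l := dot m (nu l).
  (* As [m] is orthogonal to [S], the relation of [G] for [m] involves only indices outside [S];
     cleared of denominators it is a polynomial identity. *)
  have mono : \prod_(l | l \notin S) (f (inr l) ^+ posz_part (k l) * f (inl l) ^+ negz_part (k l)) =
      \prod_(l | l \notin S) (f (inl l) ^+ posz_part (k l) * f (inr l) ^+ negz_part (k l)).
    have t0 : s * \prod_(l | l \notin S) F l != 0.
      by rewrite mulf_neq0 //; apply/prodf_neq0 => l /SF.
    apply: (mpoly_eq_on t0) => y; rewrite mevalM mulf_eq0 negb_or => /andP[sy Fy].
    have [mu [mu0 mu1] Fmu] := orb y sy.
    have Fl l : l \notin S -> (F l).@[y] != 0.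
      move=> lS; apply: contraNneq Fy => z; rewrite (bigD1 l) //= mevalM.
      by rewrite [(F l).@[y]]z mul0r.
    apply: (meval_monomial_ratio (mu := mu)) => [l _|l lS|]; first exact: mu0.
      by rewrite /f (negbTE lS); have := congr1 (@^~ l) Fmu.
    rewrite -[RHS](mu1 m) [RHS](bigID (mem S)) /= [X in _ = X * _]big1 ?mul1r //.
    by move=> l lS; rewrite mS // expr0z.
  have facs (j j' : 'I_r -> 'I_r + 'I_r) : factored_as P
      (\prod_(l | l \notin S) (f (j l) ^+ posz_part (k l) * f (j' l) ^+ negz_part (k l)))
      (fun p => \sum_(l | l \notin S) (e (j l) p * posz_part (k l) + e (j' l) p * negz_part (k l)))%N.
    apply: factored_as_prod => l _; apply: factored_asM; exact: factored_asX.
  have fr := facs inr inl; rewrite mono in fr.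
  have := factored_as_uniq uP mP (facs inl inr) fr pP.
  move=> /= /(congr1 Posz); rewrite !(big_morph Posz PoszD (erefl _)) => /eqP.
  rewrite -subr_eq0 -sumrB => /eqP h.
  apply/eqP; rewrite -subr_eq0 -sumrB; apply/eqP; rewrite -[RHS]h.
  apply: eq_bigr => l lS; rewrite (negbTE lS) -/(k l).
  rewrite {1 2}(posz_partB (k l)) !PoszD !PoszM; ring.
(* The entries are now proportional, and one point with nonzero values identifies the constants with
   an element of [G]. *)
have [y] : exists y, (s * \prod_(l | l \notin S) F l).@[y] != 0.
  by apply: mpoly_nonzero_point; rewrite mulf_neq0 //; apply/prodf_neq0 => l /SF.
rewrite mevalM mulf_eq0 negb_or => /andP[sy Fy].
have [mu Gmu Fmu] := orb y sy; exists mu => //; apply/funext => i.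
have [iS|iS] := boolP (i \in S).
  by move: iS (iS); rewrite {1}inE -zeros inE => /eqP -> /eqP ->; rewrite scaler0.
have Fi : (F i).@[y] != 0.
  apply: contraNneq Fy => z; rewrite (bigD1 i) //= mevalM.
  by rewrite [(F i).@[y]]z mul0r.
have [ci ci'] := (c0 (inl i), c0 (inr i)).
have F'E : F' i = (c (inr i) / c (inl i)) *: F i.
  have := fE (inr i); have := fE (inl i); rewrite /= (negbTE iS) => -> ->.
  rewrite scalerA divfK //; congr (_ *: _); apply: eq_big_seq => p pP.
  by rewrite exps.
by have := congr1 (@^~ i) Fmu; rewrite /poly_map /= F'E mevalZ => /(mulIf Fi) ->.
Qed.

(** In the affine chart of a full-dimensional cone [sg], each orbit has a representative whose
    coordinates outside [sg] are [1]; the others are regular on the chart, so they pull back to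
    fractions near [y0]. *)
Lemma rational_lift (phi : Defs.pmap (cpt R d) (set (cpt R r))) :
  rat_rep (affine_space R d) X phi ->
  exists (p q : 'I_r -> {mpoly C[d]}) (s : {mpoly C[d]}),
    [/\ s != 0, forall i, q i != 0, common [set i | p i == 0]%SET &
        forall y, s.@[y] != 0 -> phi.1 y /\
          phi.2 y = cox_orbit nu (fun i => (p i).@[y] / (q i).@[y])].
Proof.
case: phi => U f /= [oU [y0 Uy0] [fpts fopen freg]].
have [x0 /cox_ZNP cx0 fy0] := fpts _ Uy0.
have [sg Ssg [sd sx0 _]] := fan_full_cone_of fan_Sigma complete_Sigma 0 cx0.
have [D [DE Dd]] := fan_dual_basis smooth_Sigma Ssg sd.
pose T i := `[< sg (latt R (nu i)) >].
have DT i j : T i -> T j -> dot (D j) (nu i) = (i == j)%:R.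
  by move=> /asboolP si /asboolP sj; apply: Dd.
pose chart : set (cpt R r) := [set x | forall i, ~~ T i -> x i != 0].
pose V := cox_orbit nu @` chart.
have chart_nZ x : chart x -> (~` cox_Z Sigma nu) x.
  move=> cx; apply/cox_ZNP; exists sg => // i; rewrite inE => xi.
  by apply/asboolP/negPn/negP => /cx; rewrite xi.
have chart_mul mu x : G mu -> chart x -> chart (fun i => mu i * x i).
  by move=> [mu0 _] cx i /cx xi; rewrite mulf_neq0.
have preimV : ~` cox_Z Sigma nu `&` cox_orbit nu @^-1` V = chart.
  apply/seteqP; split=> x; last by move=> cx; split; [exact: chart_nZ|exists x].
  case=> _ [x' cx' e].
  have [mu Gmu ->] : cox_orbit nu x' x by rewrite e; apply: cox_orbit_refl.
  exact: chart_mul.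
have chart_open : zariski_open chart.
  have -> : chart = [set x : cpt R r | (\prod_(i | ~~ T i) 'X_i).@[x] != 0].
    apply/seteqP; split=> x /=; rewrite meval_prod.
      by move=> cx; apply/prodf_neq0 => i /cx; rewrite mevalXU.
    by move=> /prodf_neq0 h i /h; rewrite mevalXU.
  exact: zariski_open_basic.
have openV : open_in X V.
  split; last by rewrite preimV.
  by move=> _ [x cx <-]; exists x => //; apply: chart_nZ.
(* The coordinates of the affine chart of [sg], as monomials in the Cox
   coordinates; they are invariant under [G]. *)
pose h j (x : cpt R r) := x j * \prod_(i | ~~ T i) x i ^ dot (D j) (nu i).
have hmul j mu x : T j -> G mu -> h j (fun i => mu i * x i) = h j x.
  move=> Tj [mu0 /(_ (D j)) mu1]; rewrite /h.
  under eq_bigr => i _ do rewrite expfzMl.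
  rewrite big_split /= mulrACA (_ : mu j * _ = 1) ?mul1r //.
  rewrite -[RHS]mu1 [RHS](bigID T) /=; congr (_ * _).
  rewrite (bigD1 j) //= DT // eqxx expr1z big1 ?mulr1 //.
  by move=> i /andP[Ti ij]; rewrite DT // (negbTE ij) expr0z.
(* The chart coordinate as a function of the orbit, computed at a chosen representative; [0] is a
   default for the empty set. *)
pose H j (A : set (cpt R r)) : C :=
  if pselect (exists x, A x) is left e then h j (projT1 (cid e)) else 0.
have HE : forall j x, T j -> H j (cox_orbit nu x) = h j x.
  move=> j x Tj; rewrite /H; case: pselect => [e|[]]; last first.
    by exists x; apply: cox_orbit_refl.
  by case: (cid e) => x' /= [mu Gmu ->]; apply: hmul.
have Hreg j : T j -> regular_on X V (H j).
  move=> Tj; rewrite /= preimV => x cx.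
  exists chart, ('X_j * \prod_(i | ~~ T i) 'X_i ^+ posz_part (dot (D j) (nu i))),
    (\prod_(i | ~~ T i) 'X_i ^+ negz_part (dot (D j) (nu i))); split=> // z cz.
  rewrite mevalM !meval_prod mevalXU.
  have q0 : \prod_(i | ~~ T i) ('X_i ^+ negz_part (dot (D j) (nu i))).@[z] != 0.
    by apply/prodf_neq0 => i /cz zi; rewrite meval_exp mevalXU expf_neq0.
  split=> //=; rewrite HE // /h; apply: (mulIf q0); rewrite divfK //.
  rewrite -mulrA -big_split; congr (_ * _); apply: eq_bigr => i /cz zi /=.
  by rewrite !meval_exp !mevalXU exprz_parts.
have Vy0 : (U `&` f @^-1` V) y0.
  split=> //; exists x0 => // i; apply: contraNneq => xi.
  by apply/asboolP/sx0; rewrite inE xi.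
have oUV := fopen V openV.
have [s0 s0y s0U] := zariski_open_nbhd oUV Vy0.
have /choice[t tP] : forall j, exists t : {mpoly C[d]} * {mpoly C[d]} * {mpoly C[d]},
    t.2.@[y0] != 0 /\ forall y, t.2.@[y] != 0 ->
    t.1.2.@[y] != 0 /\ t.1.1.@[y] / t.1.2.@[y] = if T j then H j (f y) else 1.
  move=> j; case: (boolP (T j)) => Tj; last first.
    exists (1, 1, 1); split=> [|y _] /=; first by rewrite meval1 oner_neq0.
    by rewrite meval1 divr1 oner_neq0.
  have [W [p [q [oW Wy0 WU hW]]]] := freg V _ openV (Hreg j Tj) y0 Vy0.
  have [s sy sW] := zariski_open_nbhd oW Wy0.
  by exists (p, q, s); split=> // y /= /sW/hW[].
exists (fun i => (t i).1.1), (fun i => (t i).1.2), (s0 * \prod_j (t j).2); split.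
- apply/eqP => /(congr1 (meval y0)); rewrite meval0 mevalM meval_prod.
  apply/eqP; rewrite mulf_neq0 //; apply/prodf_neq0 => j _.
  by case: (tP j).
- move=> i; have [/(proj2 (tP i)) [+ _] _] := (proj1 (tP i), I).
  by apply: contraNneq => ->; rewrite meval0.
- exists sg => // i; rewrite inE => /eqP pi0.
  apply/asboolP/negPn/negP => nTi.
  have [_] := (proj2 (tP i)) y0 (proj1 (tP i)).
  rewrite (negbTE (nTi : ~~ T i)) pi0 meval0 mul0r => /esym/eqP.
  by rewrite oner_eq0.
move=> y; rewrite mevalM meval_prod mulf_eq0 negb_or => /andP[/s0U [Uy [x cx fy]]].
move=> /prodf_neq0 ty; rewrite /= in fy; split=> //.
have gE i : (t i).1.1.@[y] / (t i).1.2.@[y] = if T i then h i x else 1.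
  have [_ ->] := proj2 (tP i) y (ty i isT).
  by case: ifPn => // Ti; rewrite -fy HE.
(* [mu] scales the coordinates outside [sg] to [1] and turns [x i] inside into [h i x]; it lies in
   [G] because each [nu l] expands in the basis of [sg] through [D]. *)
pose mu i := if T i then \prod_(l | ~~ T l) x l ^ dot (D i) (nu l) else (x i)^-1.
have Gmu : G mu.
  split=> [i|m].
    rewrite /mu; case: ifPn => [_|/cx xi]; last by rewrite invr_eq0.
    by apply/prodf_neq0 => l /cx xl; apply: expfz_neq0.
  rewrite (bigID T) /= (eq_bigr (fun i =>
      \prod_(l | ~~ T l) x l ^ (dot (D i) (nu l) * dot m (nu i)))); last first.
    move=> i Ti; rewrite /mu Ti prodr_exprz; apply: eq_bigr => l _.
    by rewrite exprz_exp.
  rewrite exchange_big /= -big_split /= big1 // => l nTl.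
  rewrite -expfz_sum ?cx // /mu (negbTE nTl) exprz_inv -expfzDr ?cx //.
  rewrite {2}(DE (nu l)) dot_sumr -sumrB big1 ?expr0z // => i _.
  by rewrite dotZr subrr.
rewrite -fy -(cox_orbit_mul x Gmu); congr (cox_orbit nu _); apply/funext => i.
rewrite gE /mu; case: ifPn => [_|/cx xi]; last by rewrite mulVf.
by rewrite /h mulrC.
Qed.

(* For each prime [w], [o w] is the vector of orders of [p / q] at [w], and [a w]
   the expression of the same lattice vector in a cone of the fan. *)
Lemma sigma_irreducible_lift (p q : 'I_r -> {mpoly C[d]}) :
  (forall i, q i != 0) -> common [set i | p i == 0]%SET ->
  exists (F : 'I_r -> {mpoly C[d]}) (s : {mpoly C[d]}), [/\ irred F, s != 0 &
    forall y, s.@[y] != 0 -> exists2 mu, G mu &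
      poly_map F y = fun i => mu i * ((p i).@[y] / (q i).@[y])].
Proof.
move=> q0; set S := [set i | p i == 0]%SET => cS.
have SP i : i \notin S -> p i != 0 by rewrite inE.
pose f (j : 'I_r + 'I_r) := match j with
  | inl i => if i \in S then 1 else p i
  | inr i => q i end.
have f0 j : f j != 0.
  by case: j => i //=; case: ifPn => [_|/SP]; rewrite ?oner_neq0.
have [P [e [c [uP mP c0 fE]]]] := common_factorization f0.
pose o w i : int := if i \in S then 0 else (e (inl i) w)%:Z - (e (inr i) w)%:Z.
have /choice[a aP] w := fan_decomposition fan_Sigma complete_Sigma edges_rho
  first_nu smooth_Sigma (\sum_i o w i *: nu i) cS.
(* Outside [S] the integer [a w i] is nonnegative, so the absolute value loses nothing; the
   constants make [F] differ from [p / q] only by powers of primes. *)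
pose F i := if i \in S then 0 else
  (c (inl i) / c (inr i)) *: \prod_(w <- P) w ^+ `|a w i|%N.
have FS i : i \in S -> F i = 0 by rewrite /F => ->.
pose s := \prod_(w <- P) w.
have w0 w : w \in P -> w != 0 by move/mP => [[]].
exists F, s; split.
- apply/sigma_irreducibleE => A nA; split=> [i _|g hg].
    by exists (F i); rewrite mulr1.
  have g0 : g != 0.
    apply/eqP => g0; apply: nA; apply: in_common_coneS cS.
    apply/fintype.subsetP => i /hg[k Fk]; apply: contraT => iS.
    have : F i == 0 by rewrite Fk g0 mulr0.
    rewrite /F (negbTE iS) scaler_eq0 mulf_eq0 invr_eq0 !(negbTE (c0 _)) /=.
    rewrite prodf_seq_eq0 => /hasP[w /w0 wn0 /=].
    by rewrite expf_eq0 (negbTE wn0) andbF.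
  have [ug|nug] := boolP (g \is a GRing.unit); first by exists g^-1; rewrite mulVr.
  have [w mw [k gk]] := monic_irreducible_factor g0 nug.
  have wF i : i \in A -> i \notin S -> w \in P /\ a w i != 0.
    move=> iA iS; have [l Fl] := hg i iA.
    have : divides w (F i) by exists (l * k); rewrite Fl gk mulrA.
    rewrite /F (negbTE iS) => /(monic_irreducible_dvd_prod mw mP).
    by rewrite mulf_neq0 ?invr_eq0 // => /(_ isT)[wP]; rewrite absz_gt0.
  (* Because [w] divides the entries indexed by [A], each such index is in [S] or has [a w i]
     nonzero, and these share a cone. *)
  case: nA; apply: (in_common_coneS _ (let: And3 _ _ h := aP w in h)).
  apply/fintype.subsetP => i iA; rewrite inE; case: (boolP (i \in S)) => //= iS.
  by rewrite inE; have [] := wF i iA iS.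
- by rewrite prodf_seq_neq0; apply/allP => w /w0.
move=> y; rewrite meval_prod prodf_seq_neq0 => /allP sy.
have wy w : w \in P -> w.@[y] != 0 by move=> /sy.
exists (fun i => \prod_(w <- P) w.@[y] ^ (a w i - o w i)).
  split=> [i|m].
    by rewrite prodf_seq_neq0; apply/allP => w /wy wn0; apply: expfz_neq0.
  under eq_bigr => i _ do rewrite prodr_exprz.
  rewrite exchange_big /= big_seq big1 // => w /wy wn0.
  under eq_bigr => i _ do rewrite exprz_exp.
  rewrite -expfz_sum // (_ : \sum_i _ = 0) ?expr0z //.
  have [e1 _ _] := aP w.
  under eq_bigr => i _ do rewrite -dotZr scalerBl.
  by rewrite -dot_sumr sumrB -e1 subrr dot0r.
apply/funext => i; rewrite /poly_map.
have [iS|iS] := boolP (i \in S).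
  by rewrite FS // meval0; move: iS; rewrite inE => /eqP->; rewrite meval0 mul0r mulr0.
have fi := fE (inl i); rewrite /= (negbTE iS) in fi; have qi := fE (inr i).
rewrite /= in qi; rewrite /F (negbTE iS) fi qi !mevalZ !meval_prod.
have prod0 (k : {mpoly C[d]} -> nat) : \prod_(w <- P) (w ^+ k w).@[y] != 0.
  rewrite prodf_seq_neq0; apply/allP => w /wy wn0 /=.
  by rewrite meval_exp expf_neq0.
have -> : \prod_(w <- P) w.@[y] ^ (a w i - o w i) =
    \prod_(w <- P) (w ^+ `|a w i|).@[y] * \prod_(w <- P) (w ^+ e (inr i) w).@[y]
    / \prod_(w <- P) (w ^+ e (inl i) w).@[y].
  apply: (mulIf (prod0 (e (inl i)))); rewrite divfK // -!big_split /=.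
  apply: eq_big_seq => w /wy wn0; rewrite !meval_exp !exprnP -!expfzDr //.
  congr (_ ^ _); rewrite /o (negbTE iS) gez0_abs; first by ring.
  by have [_ + _] := aP w; apply.
rewrite invfM.
by field; rewrite !prod0 !c0.
Qed.

Lemma rational_map_lift (phi : Defs.pmap (cpt R d) (set (cpt R r))) :
  rat_rep (affine_space R d) X phi ->
  exists2 F, irred F & rat_equiv (affine_space R d) phi (pi_comp Sigma nu F).
Proof.
move=> hphi; have [p [q [s [s0 q0 cp hs]]]] := rational_lift hphi.
have [F [t [iF t0 ht]]] := sigma_irreducible_lift q0 cp.
exists F => //; exists [set y | (s * t).@[y] != 0].
have st y : (s * t).@[y] != 0 -> phi.1 y /\ phi.2 y = cox_orbit nu (poly_map F y).
  rewrite mevalM mulf_eq0 negb_or => /andP[/hs[Uy ->] /ht[mu Gmu ->]].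
  by rewrite cox_orbit_mul.
split.
- exact: zariski_open_basic.
- by have [y] := mpoly_nonzero_point (mulf_neq0 s0 t0); exists y.
(* The values of [phi] are orbits outside [cox_Z], so the value of [F] at [y] lies outside it
   too. *)
- move=> y /st[Uy phiy]; split=> //; case: hphi => _ _ [/(_ y Uy) [x nZx e] _ _].
  by apply/(cox_Z_orbit Sigma (etrans (esym phiy) (esym e))).
- by move=> y /st[].
Qed.

End Lifting.

(** * Correspondence between rational maps and classes of irreducible tuples *)

Theorem theorem5p1 (R : realType) (n r d : nat)
    (Sigma : set (set 'rV[R]_n))
    (rho : 'I_r -> set 'rV[R]_n) (nu : 'I_r -> 'rV[int]_n)
    (fan_Sigma : is_fan Sigma)
    (complete_Sigma : complete_fan Sigma)
    (edges_rho : edges_of Sigma rho)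
    (first_nu : forall i, first_lattice_vector (rho i) (nu i))
    (smooth_Sigma : smooth_fan Sigma nu) :
  let Cd := affine_space R d in
  let X := toric_variety Sigma nu in
  let irred := fun F : 'I_r -> {mpoly R[i][d]} =>
    sigma_irreducible Sigma rho F in
  let piF := fun F : 'I_r -> {mpoly R[i][d]} =>
    rat_class Cd X (pi_comp Sigma nu F) in
  [/\ forall F, irred F -> rat_rep Cd X (pi_comp Sigma nu F),
      forall F F', irred F -> irred F' ->
        (piF F = piF F' <-> g_equivalent nu F F'),
      forall f, rational_maps Cd X f -> exists2 F, irred F & f = piF F &
      exists2 Phi,
        (forall F, irred F -> Phi (g_class nu F) = piF F) &
        set_bij [set c | exists2 F, irred F & c = g_class nu F]
                (rational_maps Cd X) Phi].
Proof.
move=> Cd X irred piF.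
have rep F : irred F -> rat_rep Cd X (pi_comp Sigma nu F).
  move=> iF; apply: pi_comp_rat_rep.
  exact: (sigma_irreducible_zeros fan_Sigma edges_rho first_nu iF).
have eqF F F' : irred F -> irred F' -> (piF F = piF F' <-> g_equivalent nu F F').
  move=> iF iF'; split=> [/(rat_class_eqP _ (rep F' iF'))|e].
    exact: (pi_comp_injective fan_Sigma complete_Sigma edges_rho first_nu
      smooth_Sigma iF iF').
  by rewrite /piF (pi_comp_g_equivalent Sigma e).
have surj f : rational_maps Cd X f -> exists2 F, irred F & f = piF F.
  case=> phi hphi ->; have [F iF e] := rational_map_lift fan_Sigma
    complete_Sigma edges_rho first_nu smooth_Sigma hphi.
  by exists F => //; apply/(rat_class_eqP _ (rep F iF)).
split=> //.
(* [Phi] is evaluated at a chosen member of the class; classes are nonempty, so [set0] is only a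
   default. *)
pose Phi (c : set ('I_r -> {mpoly R[i][d]})) :=
  if pselect (exists F, c F) is left e then piF (projT1 (cid e)) else set0.
have PhiE F : Phi (g_class nu F) = piF F.
  rewrite /Phi; case: pselect => [e|[]]; last first.
    by exists F; apply: g_equivalent_refl.
  by case: (cid e) => F' /= hF'; rewrite /piF (pi_comp_g_equivalent Sigma hF').
exists Phi => //; split.
- move=> _ [F iF ->]; rewrite PhiE; exists (pi_comp Sigma nu F) => //.
  exact: rep.
- move=> c c' /set_mem[F iF ->] /set_mem[F' iF' ->]; rewrite !PhiE.
  by move=> /(eqF _ _ iF iF')/g_class_eq.
- move=> f /surj[F iF ->]; exists (g_class nu F) => //; by exists F.
Qed.
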